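(* Let $n \geq 2$, let $X_1, \dots, X_n$ be real numbers that are not all equal, with empirical distribution function $\mathbb{F}_n$, and let $\hat{f}_n$ denote the corresponding log-concave maximum likelihood estimator. Let $X_{(1)} := \min_i X_i$ and $X_{(n)} := \max_i X_i$. Let $f_0$ be a density on $\mathbb{R}$ such that $f_0(x) = e^{\alpha_0 x}h_0(x)$ for $x \in [X_{(1)},X_{(n)}]$, where $\alpha_0 \in \mathbb{R}$ and $h_0:[X_{(1)},X_{(n)}] \rightarrow \mathbb{R}$ is concave, and let $\kappa := \alpha_0(X_{(n)} - X_{(1)})$. Writing $F_0$ and $\hat{F}_n$ for the distribution functions corresponding to $f_0$ and $\hat{f}_n$ respectively, we have $$\|\hat{F}_n - F_0\|_\infty \leq \rho(|\kappa|)\,\|\mathbb{F}_n - F_0\|_\infty.$$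
   Context: A density $f$ on $\mathbb{R}$ is log-concave if $f = e^{\phi}$ for some concave $\phi:\mathbb{R}\to[-\infty,\infty)$. $\mathcal{F}$ is the set of all upper semi-continuous log-concave densities on $\mathbb{R}$. Given real data $X_1,\ldots,X_n$ that are not all equal, the log-concave maximum likelihood estimator $\hat f_n$ is the unique maximiser of $\sum_{i=1}^n \log f(X_i)$ over $f\in\mathcal{F}$. The empirical distribution function is $\mathbb{F}_n(x) := n^{-1}\sum_{i=1}^n \mathbf{1}_{\{X_i\le x\}}$, and $\|g\|_\infty := \sup_{x\in\mathbb{R}}|g(x)|$. Define the continuous, strictly increasing function $q:\mathbb{R}\to[0,1]$ by $q(x) := \frac{x-2+e^{-x}(x+2)}{x\{1-e^{-x}(x+1)\}}$ for $x\neq 0$ and $q(0):=\frac13$, and set $\rho(x) := \frac{1+q(x)}{1-q(x)}$. *)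

(* Defs.v *)
From mathcomp Require Import all_boot all_order all_algebra.
From mathcomp Require Import all_classical all_reals all_analysis.

Set Implicit Arguments.
Unset Strict Implicit.
Unset Printing Implicit Defensive.

Import Order.TTheory GRing.Theory Num.Theory.
Import numFieldNormedType.Exports.

Local Open Scope classical_set_scope.
Local Open Scope ring_scope.

Definition is_density (R : realType) (f : R -> R) : Prop :=
  [/\ measurable_fun [set: R] f,
      forall x, 0 <= f x &
      (\int[@lebesgue_measure R]_x (f x)%:E = 1)%E].

(* As 0 * -oo = 0 and phi never takes the value +oo where this is used, the
   left-hand side is always well defined. *)
Definition ereal_concave (R : realType) (phi : R -> \bar R) : Prop :=
  forall x y t : R, 0 <= t <= 1 ->
    (t%:E * phi x + (1 - t)%:E * phi y <= phi (t * x + (1 - t) * y)%R)%E.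

(* f = e^phi with e^-oo = 0. *)
Definition log_concave (R : realType) (f : R -> R) : Prop :=
  exists phi : R -> \bar R,
    [/\ forall x, (phi x < +oo)%E,
        ereal_concave phi &
        forall x, (f x)%:E = expeR (phi x)].

Definition upper_semicontinuous (R : realType) (f : R -> R) : Prop :=
  lower_semicontinuous (fun x => (- f x)%:E).

Definition usc_log_concave_density (R : realType) : set (R -> R) :=
  [set f | [/\ is_density f, log_concave f & upper_semicontinuous f]].

(* lne 0 = -oo, so that a density vanishing at some X i has log-likelihood
   -oo. *)
Definition log_likelihood (R : realType) (n : nat) (X : 'I_n -> R)
    (f : R -> R) : \bar R :=
  (\sum_(i < n) lne (f (X i))%:E)%E.

(* Uniqueness of the maximiser, valid when the X i are not all equal, is a
   theorem about this predicate rather than a part of it. *)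
Definition is_log_concave_mle (R : realType) (n : nat) (X : 'I_n -> R)
    (fhat : R -> R) : Prop :=
  usc_log_concave_density fhat /\
  forall f, usc_log_concave_density f ->
    (log_likelihood X f <= log_likelihood X fhat)%E.

(* The starting value of the iterated min (max) is the first observation,
   hence irrelevant as soon as 0 < n. *)
Definition sample_min (R : realType) (n : nat) (X : 'I_n -> R) : R :=
  \big[Num.min/head 0 (codom X)]_(i < n) X i.

Definition sample_max (R : realType) (n : nat) (X : 'I_n -> R) : R :=
  \big[Num.max/head 0 (codom X)]_(i < n) X i.

Definition empirical_df (R : realType) (n : nat) (X : 'I_n -> R) (x : R) : R :=
  n%:R^-1 * \sum_(i < n) (X i <= x)%R%:R.

Definition distribution_function (R : realType) (f : R -> R) (x : R) : R :=
  \int[@lebesgue_measure R]_(t in `]-oo, x]) f t.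

Definition sup_norm (R : realType) (g : R -> R) : \bar R :=
  ereal_sup (range (fun x => `|g x|%:E)).

Definition concave_on (R : realType) (D : set R) (h : R -> R) : Prop :=
  @convex_function R R^o D (fun x => - h x).

Definition q (R : realType) (x : R) : R :=
  if x == 0 then 3^-1
  else (x - 2 + expR (- x) * (x + 2)) / (x * (1 - expR (- x) * (x + 1))).

Definition rho (R : realType) (x : R) : R := (1 + q x) / (1 - q x).

(* Main.v *)
Require Import Defs.
From mathcomp Require Import all_boot all_order all_algebra.
From mathcomp Require Import all_classical all_reals all_analysis.
From mathcomp Require Import measurable_realfun ring lra.
Set Implicit Arguments.
Unset Strict Implicit.
Unset Printing Implicit Defensive.
Import Order.TTheory GRing.Theory Num.Theory.
Import numFieldNormedType.Exports.
Local Open Scope classical_set_scope.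
Local Open Scope ring_scope.

(** The proof follows the pattern of Marshall's inequality. Write D for the
difference of the distribution functions of the estimator f and of f0, and
delta for the distance between the empirical distribution function Fn and F0.

Since f maximises the likelihood, first-order optimality (mle_first_order) along
concave directions says that, for all z, the integral of the distribution
function of f up to z is at most that of Fn (mle_hinge_le), with equality when
z is a kink of ln f or an end of the support (mle_kink). Such points are called
balanced. Comparing integrals over short intervals on both sides of a balanced
point shows that |D| <= delta there (balanced_df). Moreover ln f is affine between
consecutive data points (mle_affine_gap), so every point of the support lies in
an interval [s, t] with balanced ends on which ln f is affine
(mle_affine_cell).

On [s, t] the derivative of D is e^(alpha x) g x, where g is the difference of
an exponential and a concave function, hence convex. If D is maximal at u
strictly between s and t, then g crosses 0 downwards at u, so by convexity it is
nonnegative on [s, u] and g x / (u - x) decreases (convex3_downcross). In terms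
of y = (x - s) / (u - s), the derivative of D divided by the weight
(1 - y) e^(k y) is then nonincreasing for k = |kappa|, because
alpha (u - s) <= k. The mean of y under that weight is exactly q k (q_mean), so
its mean under the derivative of D is at most q k (ramp_mean_le). After an
integration by parts this reads

  (1 - q k) D u <= (mean of D over [s, u]) - q k D s

(df_sub_max). As s is balanced, the mean of D over [s, u] is at most the mean of
Fn - F0, hence at most delta, and - D s <= delta. Therefore
D u <= delta (1 + q k) / (1 - q k). A minimum is treated in the same way with
the roles of s and t exchanged (df_sub_min). *)

(** * Log-concave and upper semicontinuous functions *)

(** Log-concavity of f stated with the real-valued ln, used only at points
where f is positive. That f stays positive between two such points has to be
part of the conclusion, since ln is not -oo at 0. *)
Definition ln_concave (R : realType) (f : R -> R) : Prop :=
  forall x y t : R, 0 <= t <= 1 -> 0 < f x -> 0 < f y ->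
    0 < f (t * x + (1 - t) * y) /\
    t * ln (f x) + (1 - t) * ln (f y) <= ln (f (t * x + (1 - t) * y)).

Section LogConcave.
Context {R : realType}.
Implicit Types (f g : R -> R) (x y z t : R).

Lemma log_concave_ln f : log_concave f -> ln_concave f.
Proof.
case=> phi [phioo cphi fE] x y t t01 fx fy.
have phiE z : 0 < f z -> phi z = (ln (f z))%:E.
  by move=> fz; rewrite -lne_EFin// fE expeRK.
have := cphi x y t t01; rewrite (phiE x fx) (phiE y fy) -!EFinM -EFinD => le.
have fz : 0 < f (t * x + (1 - t) * y).
  rewrite -lte_fin fE; case: (phi _) le => [r| |]//= _.
    by rewrite lte_fin expR_gt0.
  by rewrite ltry.
by split=> //; move: le; rewrite phiE// lee_fin.
Qed.

Lemma ln_concave_log f : (forall x, 0 <= f x) -> ln_concave f -> log_concave f.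
Proof.
move=> f0 cf; exists (fun x => lne (f x)%:E); split.
- by move=> x /=; case: ifP => // _; rewrite ltry.
- move=> x y t t01; have /andP[t0 t1] := t01.
  have [->|tn0] := eqVneq t 0.
    by rewrite mul0e add0e subr0 mul1e mul0r add0r mul1r.
  have [->|tn1] := eqVneq t 1.
    by rewrite subrr mul0e adde0 !mul1e mul0r addr0 mul1r.
  have tp : 0 < t by rewrite lt_neqAle eq_sym tn0.
  have tp1 : 0 < 1 - t by rewrite subr_gt0 lt_neqAle tn1.
  have [fx|fx] := ltP 0 (f x); last first.
    by rewrite (le0_lneNy (x := (f x)%:E))// gt0_muleNy// leNye.
  have [fy|fy] := ltP 0 (f y); last first.
    rewrite (le0_lneNy (x := (f y)%:E))// gt0_muleNy//.
    by rewrite lne_EFin// addeNy// leNye.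
  have [fz le] := cf x y t t01 fx fy.
  by rewrite !lne_EFin// -!EFinM -EFinD lee_fin.
- by move=> x; rewrite lneK// in_itv/= leey lee_fin f0.
Qed.

(** Denominators are cleared so that linear arithmetic can combine several
instances. *)
Lemma ln_concave3 f x y z : ln_concave f -> x <= y <= z -> x < z ->
  0 < f x -> 0 < f z ->
  0 < f y /\ (z - y) * ln (f x) + (y - x) * ln (f z) <= (z - x) * ln (f y).
Proof.
move=> cf /andP[xy yz] xz fx fz.
have zx : 0 < z - x by rewrite subr_gt0.
pose t := (z - y) / (z - x).
have t01 : 0 <= t <= 1.
  by rewrite /t divr_ge0 ?ler_pdivrMr// ?mul1r; lra.
have e : t * x + (1 - t) * z = y.
  by rewrite /t; field; rewrite subr_eq0 gt_eqF.
have := cf x z t t01 fx fz; rewrite e => -[fy le]; split=> //.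
have -> : (z - y) * ln (f x) + (y - x) * ln (f z) =
    (z - x) * (t * ln (f x) + (1 - t) * ln (f z)).
  by rewrite /t; field; rewrite subr_eq0 gt_eqF.
by rewrite ler_pM2l.
Qed.

Lemma ln_concave_from3 f :
  (forall x y z, x < y < z -> 0 < f x -> 0 < f z ->
    0 < f y /\ (z - y) * ln (f x) + (y - x) * ln (f z) <= (z - x) * ln (f y)) ->
  ln_concave f.
Proof.
move=> cf.
have main x y t : x < y -> 0 < t < 1 -> 0 < f x -> 0 < f y ->
    0 < f (t * x + (1 - t) * y) /\
    t * ln (f x) + (1 - t) * ln (f y) <= ln (f (t * x + (1 - t) * y)).
  move=> xy /andP[t0 t1] fx fy; set m := t * x + _.
  have [|fm le] := cf x m y _ fx fy; first by rewrite /m; apply/andP; split; nra.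
  split=> //.
  have yx : 0 < y - x by rewrite subr_gt0.
  rewrite -(ler_pM2l yx); apply: le_trans le.
  by rewrite le_eqVlt; apply/orP; left; apply/eqP; rewrite /m; ring.
move=> x y t /andP[t0 t1] fx fy.
have [->|tn0] := eqVneq t 0; first by rewrite !mul0r !add0r subr0 !mul1r.
have [->|tn1] := eqVneq t 1; first by rewrite subrr !mul0r !addr0 !mul1r.
have tp : 0 < t by rewrite lt_neqAle eq_sym tn0.
have tp1 : t < 1 by rewrite lt_neqAle tn1.
have [xy|yx|<-] := ltgtP x y.
- by apply: main => //; apply/andP.
- have := @main y x (1 - t) yx _ fy fx.
  rewrite subKr [_ * y + _]addrC [_ * ln (f y) + _]addrC; apply.
  by apply/andP; split; lra.
- by rewrite -!mulrDl addrC subrK !mul1r.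
Qed.

Lemma ln_concave_min f g : ln_concave f -> ln_concave g ->
  ln_concave (fun x => Num.min (f x) (g x)).
Proof.
move=> cf cg x y t t01 /=; rewrite !lt_min => /andP[fx gx] /andP[fy gy].
have [fm lef] := cf _ _ _ t01 fx fy; have [gm leg] := cg _ _ _ t01 gx gy.
rewrite fm gm; split=> //; move/andP: t01 => [t0 t1].
have t1' : 0 <= 1 - t by rewrite subr_ge0.
have lnmin u v : 0 < u -> 0 < v -> ln (Num.min u v) = Num.min (ln u) (ln v) :> R.
  move=> u0 v0; have [uv|vu] := leP u v.
    by rewrite min_l// ler_ln// posrE.
  by rewrite min_r// ler_ln// ?posrE// ltW.
rewrite [leRHS]lnmin// le_min; apply/andP; split.
- apply: le_trans lef; apply: lerD; apply: ler_wpM2l => //.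
    by rewrite ler_ln ?posrE ?lt_min ?fx ?gx// ge_min lexx.
  by rewrite ler_ln ?posrE ?lt_min ?fy ?gy// ge_min lexx.
- apply: le_trans leg; apply: lerD; apply: ler_wpM2l => //.
    by rewrite ler_ln ?posrE ?lt_min ?fx ?gx// ge_min lexx orbT.
  by rewrite ler_ln ?posrE ?lt_min ?fy ?gy// ge_min lexx orbT.
Qed.

Lemma ln_concaveM_expR f (d : R -> R) : ln_concave f ->
  (forall x y t, 0 <= t <= 1 ->
    t * d x + (1 - t) * d y <= d (t * x + (1 - t) * y)) ->
  ln_concave (fun x => f x * expR (d x)).
Proof.
move=> cf cd x y t t01 /=; rewrite !pmulr_lgt0 ?expR_gt0// => fx fy.
have [fm lef] := cf _ _ _ t01 fx fy; have := cd x y t t01.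
by rewrite !lnM ?posrE ?expR_gt0// !expRK; split=> //; lra.
Qed.

Lemma ln_concave_indic f (a b : R) : ln_concave f ->
  ln_concave (fun x => f x * (a <= x <= b)%R%:R).
Proof.
move=> cf x y t t01 /=.
have [xab|_] := boolP (a <= x <= b); last by rewrite mulr0 ltxx.
have [yab|_] := boolP (a <= y <= b); last by rewrite mulr0 ltxx.
rewrite !mulr1 => fx fy; have := cf x y t t01 fx fy.
have -> : a <= t * x + (1 - t) * y <= b; last by rewrite mulr1.
by move/andP: t01 xab yab => [t0 t1] /andP[? ?] /andP[? ?]; apply/andP; split; nra.
Qed.

Lemma ln_concave_expR (d : R -> R) :
  (forall x y t, 0 <= t <= 1 ->
    t * d x + (1 - t) * d y <= d (t * x + (1 - t) * y)) ->
  ln_concave (fun x => expR (d x)).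
Proof.
by move=> cd x y t t01 _ _; rewrite !expRK expR_gt0; split=> //; exact: cd.
Qed.

Lemma usc_nearP f : upper_semicontinuous f <->
  forall x a, f x < a -> \forall y \near x, f y < a.
Proof.
split=> [uf x a fxa|uf x a].
  have [|V nV VP] := uf x (- a); first by rewrite lte_fin ltrN2.
  by apply: filterS nV => y /VP; rewrite lte_fin ltrN2.
rewrite lte_fin ltrNr => /uf nV; exists [set y | f y < - a] => //.
by move=> y /=; rewrite lte_fin ltrNr.
Qed.

Lemma continuous_usc f : continuous f -> upper_semicontinuous f.
Proof. by move=> cf; apply/usc_nearP => x a; exact: (cvgr_lt (f x) (cf x)). Qed.

Lemma usc_min f g : upper_semicontinuous f -> upper_semicontinuous g ->
  upper_semicontinuous (fun x => Num.min (f x) (g x)).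
Proof.
move=> /usc_nearP uf /usc_nearP ug; apply/usc_nearP => x a.
rewrite gt_min => /orP[/uf|/ug]; apply: filterS => y ya.
  by rewrite gt_min ya.
by rewrite gt_min ya orbT.
Qed.

Lemma uscM_expR f (d : R -> R) : upper_semicontinuous f -> continuous d ->
  upper_semicontinuous (fun x => f x * expR (d x)).
Proof.
move=> /usc_nearP uf cd; apply/usc_nearP => x a.
rewrite -ltr_pdivlMr ?expR_gt0// -expRN => fxa.
have [c fxc ca] : exists2 c, f x < c & c < a * expR (- d x).
  by exists ((f x + a * expR (- d x)) / 2); lra.
have nf := uf _ _ fxc.
have : continuous (fun y => a * expR (- d y)).
  move=> y; apply: cvgM; first exact: cvg_cst.
  apply: (@continuous_comp R R R (fun y => - d y)); last exact: continuous_expR.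
  by apply: cvgN; exact: cd.
move=> /(_ x) /cvgr_gt/(_ _ ca) ne.
near=> y; rewrite -ltr_pdivlMr ?expR_gt0// -expRN.
by apply: (@lt_trans _ _ c); [near: y|near: y].
Unshelve. all: by end_near. Qed.

Lemma usc_indic f (a b : R) : (forall x, 0 <= f x) -> upper_semicontinuous f ->
  upper_semicontinuous (fun x => f x * (a <= x <= b)%R%:R).
Proof.
move=> f0 /usc_nearP uf; apply/usc_nearP => x c.
have [xab|xab] := boolP (a <= x <= b).
  rewrite mulr1 => /uf; apply: filterS => y.
  by apply: le_lt_trans; rewrite ler_piMr// lern1 leq_b1.
rewrite mulr0 => c0.
have : (x \in ~` [set` `[a, b]]) by rewrite inE /= in_itv/=; exact/negP.
rewrite inE => xn; have : open (~` [set` `[a, b]]).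
  by apply: closed_openC; exact: itv_closed.
rewrite openE => /(_ _ xn); apply: filterS => y /=.
by rewrite in_itv/= => /negP/negbTE ->; rewrite mulr0.
Qed.

End LogConcave.

(** * Integrals and competitors of the maximiser *)

Section Integrals.
Context {R : realType}.
Local Notation mu := (@lebesgue_measure R).
Implicit Types (f g : R -> R) (a b x : R).

Lemma density_integrable f : is_density f -> mu.-integrable setT (EFin \o f).
Proof.
case=> mf f0 f1; apply/integrableP; split; first exact/measurable_EFinP.
have -> : (\int[mu]_x `|(EFin \o f) x| = \int[mu]_x (f x)%:E)%E.
  by apply: eq_integral => x _ /=; rewrite ger0_norm.
by rewrite f1 ltry.
Qed.

Lemma density_Rintegral f : is_density f -> \int[mu]_x f x = 1.
Proof. by case=> _ _; rewrite /Rintegral => ->. Qed.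

Lemma integrable_sub f g (D : set (measurableTypeR R)) : measurable D ->
  mu.-integrable D (EFin \o f) -> mu.-integrable D (EFin \o g) ->
  mu.-integrable D (EFin \o (fun x => f x - g x)).
Proof.
move=> mD intf intg; have := integrableB mD intf intg.
by apply: eq_integrable => // x _; rewrite /= EFinB.
Qed.

Lemma integrable_add f g (D : set (measurableTypeR R)) : measurable D ->
  mu.-integrable D (EFin \o f) -> mu.-integrable D (EFin \o g) ->
  mu.-integrable D (EFin \o (fun x => f x + g x)).
Proof.
move=> mD intf intg; have := integrableD mD intf intg.
by apply: eq_integrable => // x _; rewrite /= EFinD.
Qed.

Lemma integrable_scale c f (D : set (measurableTypeR R)) : measurable D ->
  mu.-integrable D (EFin \o f) -> mu.-integrable D (EFin \o (fun x => c * f x)).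
Proof.
move=> mD intf; have := integrableZl mD c intf.
by apply: eq_integrable => // x _; rewrite /= EFinM.
Qed.

Lemma Rintegral_gt0_itv f a b : mu.-integrable setT (EFin \o f) ->
  (forall x, 0 <= f x) -> a < b -> (forall x, a < x < b -> 0 < f x) ->
  0 < \int[mu]_x f x.
Proof.
move=> intf f0 ab fab; rewrite lt_neqAle Rintegral_ge0 ?andbT//.
apply/negP => /eqP /esym int0.
have mf := measurable_int _ intf.
have /(ae_eq_integral_abs mu measurableT mf) : (\int[mu]_x `|(EFin \o f) x| = 0)%E.
  transitivity (\int[mu]_x (EFin \o f) x)%E.
    by apply: eq_integral => x _ /=; rewrite ger0_norm.
  rewrite -[LHS]fineK ?integrable_fin_num//.
  by move: int0; rewrite /Rintegral => ->.
move=> ae0.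
have : mu.-negligible (`]a, b[%classic : set R).
  apply: negligibleS ae0 => x /=; rewrite in_itv/= => xab /(_ I) /eqP.
  by rewrite /= eqe gt_eqF// fab.
rewrite negligibleP; last exact: measurable_itv.
rewrite /= lebesgue_measure_itv/= lte_fin ab => /eqP.
by rewrite -EFinB eqe subr_eq0 gt_eqF.
Qed.

Lemma Rintegral_itv_indic a b : a <= b ->
  mu.-integrable setT (EFin \o fun x => (a <= x <= b)%R%:R) /\
  \int[mu]_x (a <= x <= b)%R%:R = b - a.
Proof.
move=> ab.
have e : (fun x => (a <= x <= b)%R%:R) = \1_(`[a, b]%classic : set R) :> (R -> R).
  by apply/funext => x; rewrite indicE mem_setE in_itv.
rewrite e; split; first exact: integrable_indic_itv.
rewrite /Rintegral integral_indic//= setIT lebesgue_measure_itv/= lte_fin.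
by case: ltgtP ab => // -> _; rewrite subrr.
Qed.

Lemma integrable_itv_indic f a b : mu.-integrable setT (EFin \o f) ->
  mu.-integrable setT (EFin \o fun x => f x * (a <= x <= b)%R%:R).
Proof.
move=> intf.
have -> : (fun x => f x * (a <= x <= b)%R%:R) = f \_ `[a, b].
  apply/funext => x; rewrite patchE mem_setE in_itv/=.
  by case: (a <= x <= b); rewrite ?mulr1 ?mulr0.
rewrite -restrict_EFin; apply/integrable_restrict => //; rewrite ?setTI//.
by apply: integrableS intf.
Qed.

End Integrals.

Section Likelihood.
Context {R : realType} (n : nat) (X : 'I_n -> R).
Local Notation mu := (@lebesgue_measure R).
Implicit Types (f g : R -> R) (a b x : R).

Lemma log_likelihoodE f : (forall i, 0 < f (X i)) ->
  log_likelihood X f = (\sum_(i < n) ln (f (X i)))%:E.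
Proof.
by move=> f0; rewrite /log_likelihood -sumEFin; apply: eq_bigr => i _; rewrite lne_EFin.
Qed.

Lemma log_likelihood_fin f (r : R) : (r%:E <= log_likelihood X f)%E ->
  forall i, 0 < f (X i).
Proof.
move=> le i; rewrite ltNge; apply/negP => fi; move: le.
rewrite /log_likelihood (bigD1 i)//= fi addNye leNgt => /negP; apply.
exact: ltNyr.
Qed.

(** A competitor need not be normalised: dividing it by its mass N changes its
log-likelihood by - n ln N. *)
Lemma mle_competitor f g : is_log_concave_mle X f ->
  (forall x, 0 <= g x) -> ln_concave g -> upper_semicontinuous g ->
  mu.-integrable setT (EFin \o g) -> 0 < \int[mu]_x g x ->
  (forall i, 0 < g (X i)) ->
  ((\sum_(i < n) ln (g (X i)) - n%:R * ln (\int[mu]_x g x))%:E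
    <= log_likelihood X f)%E.
Proof.
move=> [_ mle] g0 cg ug intg; set N := \int[mu]_x g x => N0 gX.
pose h x := g x * expR (- ln N).
have hX i : 0 < h (X i) by rewrite mulr_gt0// expR_gt0.
have := mle h; rewrite log_likelihoodE//.
have -> : \sum_(i < n) ln (h (X i)) = \sum_(i < n) ln (g (X i)) - n%:R * ln N.
  under eq_bigr => i _ do rewrite lnM ?posrE ?expR_gt0// expRK.
  by rewrite big_split/= sumr_const card_ord mulr_natl mulNrn.
apply; have h0 x : 0 <= h x by rewrite mulr_ge0// expR_ge0.
split; last 1 first.
- by apply: uscM_expR => // x; exact: cvg_cst.
- split=> //.
    apply: measurable_funM => //.
    by apply/measurable_EFinP; exact: (measurable_int _ intg).
  under eq_integral do rewrite EFinM.
  rewrite integralZr// -[X in (X * _)%E]fineK ?integrable_fin_num// -/N.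
  by rewrite -EFinM expRN lnK// divff// gt_eqF.
- apply: ln_concave_log => //; apply: ln_concaveM_expR => // x y t _.
  by rewrite -mulrDl addrC subrK mul1r.
Qed.

(** The uniform density on the range of the data has a finite log-likelihood,
so the maximal log-likelihood is not -oo. *)
Lemma mle_gt0 f a b : is_log_concave_mle X f -> a < b ->
  (forall i, a <= X i <= b) -> forall i, 0 < f (X i).
Proof.
move=> mle ab Xab.
have [inti int1] := Rintegral_itv_indic (ltW ab).
pose g x : R := (fun=> expR 0) x * (a <= x <= b)%R%:R.
have gE : g = fun x => (a <= x <= b)%R%:R.
  by apply/funext => x; rewrite /g expR0 mul1r.
apply: log_likelihood_fin (mle_competitor (g := g) mle _ _ _ _ _ _).
- by move=> x; rewrite gE.
- by apply: ln_concave_indic; apply: ln_concave_expR => x y t _; rewrite !mulr0 addr0.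
- by apply: usc_indic => [x|]; [exact: expR_ge0|apply: continuous_usc => x; exact: cvg_cst].
- by rewrite gE.
- by rewrite gE int1 subr_gt0.
- by move=> i; rewrite gE Xab.
Qed.

(** A log-concave function below the maximiser that interpolates it at the
data has at least the same likelihood once normalised, hence cannot have lost
any mass. *)
Lemma mle_minorant f g : is_log_concave_mle X f -> (0 < n)%N ->
  (forall i, 0 < f (X i)) -> (forall i, g (X i) = f (X i)) ->
  (forall x, 0 <= g x) -> (forall x, g x <= f x) ->
  measurable_fun setT g -> ln_concave g -> upper_semicontinuous g ->
  0 < \int[mu]_x g x ->
  mu.-integrable setT (EFin \o g) /\ \int[mu]_x g x = 1.
Proof.
move=> mle n0 fX gX g0 gf mg cg ug N0.
have df := mle.1; case: df => df _ _.
have intf := density_integrable df.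
have intg : mu.-integrable setT (EFin \o g).
  apply: le_integrable intf => //; first exact/measurable_EFinP.
  by move=> x _ /=; rewrite lee_fin ger0_norm// ger0_norm// (le_trans (g0 x)).
split=> //; apply/eqP; rewrite eq_le; apply/andP; split.
  by rewrite -(density_Rintegral df); apply: le_Rintegral.
have gX0 i : 0 < g (X i) by rewrite gX.
have := mle_competitor mle g0 cg ug intg N0 gX0.
rewrite log_likelihoodE// lee_fin; under eq_bigr do rewrite gX.
rewrite -[leRHS]addr0 lerD2l oppr_le0 pmulr_rge0 ?ltr0n//.
by rewrite -ln1 ler_ln ?posrE.
Qed.

End Likelihood.

(** * Support and piecewise affinity of the estimator *)

Section Support.
Context {R : realType} (n : nat) (X : 'I_n -> R).
Local Notation mu := (@lebesgue_measure R).
Implicit Types (f g : R -> R) (a b x : R).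

(** The gap f - g is nonnegative and has integral 0 over the line, hence over
every set. *)
Lemma le_density_eq_Rintegral f g : is_density f -> is_density g ->
  (forall x, g x <= f x) ->
  forall D, measurable D -> \int[mu]_(x in D) g x = \int[mu]_(x in D) f x.
Proof.
move=> df dg gf D mD.
have [intf intg] := (density_integrable df, density_integrable dg).
have intD h : mu.-integrable setT (EFin \o h) -> mu.-integrable D (EFin \o h).
  exact: integrableS.
have intDC h : mu.-integrable setT (EFin \o h) -> mu.-integrable (~` D) (EFin \o h).
  by apply: integrableS => //; exact: measurableC.
have split_int h : is_density h ->
    1 = \int[mu]_(x in D) h x + \int[mu]_(x in ~` D) h x.
  move=> dh; rewrite -(density_Rintegral dh) -(setUv D) Rintegral_setU//.
  - exact: measurableC.
  - by rewrite setUv; exact: density_integrable.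
  - by apply/disj_setPS; rewrite setICr.
apply/eqP; rewrite eq_le; apply/andP; split.
  by apply: le_Rintegral => //; exact: intD.
have le : \int[mu]_(x in ~` D) g x <= \int[mu]_(x in ~` D) f x.
  by apply: le_Rintegral => //; [exact: measurableC|exact: intDC|exact: intDC].
rewrite -(lerD2r (\int[mu]_(x in ~` D) f x)) -(split_int f df).
by rewrite [leLHS](split_int g dg) lerD2l.
Qed.

(** The maximiser carries no mass outside the range of the data, so that
nothing is lost in assuming that it vanishes there. *)
Lemma mle_restrict f a b : is_log_concave_mle X f -> a < b ->
  (forall i, a <= X i <= b) -> (exists i, X i = a) -> (exists i, X i = b) ->
  let g := fun x => f x * (a <= x <= b)%R%:R in
  is_log_concave_mle X g /\
  forall x, distribution_function g x = distribution_function f x.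
Proof.
move=> mle ab Xab [ia Xa] [ib Xb] g.
have [df lf uf] := mle.1; have [mf f0 _] := df.
have n0 : (0 < n)%N by exact: leq_ltn_trans (leq0n ia) (ltn_ord ia).
have fX := mle_gt0 mle ab Xab.
have fa : 0 < f a by rewrite -Xa.
have fb : 0 < f b by rewrite -Xb.
have cf := log_concave_ln lf.
have g0 x : 0 <= g x by rewrite mulr_ge0.
have gf x : g x <= f x by rewrite ler_piMr// lern1 leq_b1.
have gX i : g (X i) = f (X i) by rewrite /g Xab mulr1.
have cg : ln_concave g by exact: ln_concave_indic.
have ug : upper_semicontinuous g by exact: usc_indic.
have iint := integrable_itv_indic a b (density_integrable df).
have mg : measurable_fun setT g.
  by apply/measurable_EFinP; exact: (measurable_int _ iint).
have [|intg int1] := mle_minorant mle n0 fX gX g0 gf mg cg ug.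
  apply: (Rintegral_gt0_itv iint g0 ab) => x /andP[ax xb].
  have [|fx _] := ln_concave3 (y := x) cf _ ab fa fb.
    by rewrite !ltW.
  by rewrite /g !ltW// mulr1.
have dg : is_density g.
  by split=> //; rewrite -[LHS]fineK ?integrable_fin_num//; congr EFin.
split; last by move=> x; apply: le_density_eq_Rintegral => //; exact: measurable_itv.
split; first by split=> //; exact: ln_concave_log.
move=> h hh; rewrite [leRHS]log_likelihoodE; last by move=> i; rewrite gX.
under eq_bigr do rewrite gX.
by rewrite -log_likelihoodE//; exact: mle.2.
Qed.

Lemma ln_concave_chord_out f a b p r x : ln_concave f -> a < b ->
  0 < f a -> 0 < f b -> ln (f a) = p * a + r -> ln (f b) = p * b + r ->
  x <= a \/ b <= x -> 0 <= f x -> f x <= expR (p * x + r).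
Proof.
move=> cf ab fa fb ea eb xab; rewrite le_eqVlt => /predU1P[<-|fx].
  exact: expR_ge0.
rewrite -ler_ln ?posrE ?expR_gt0// expRK.
case: xab => [xa|bx].
- have [| |_] := ln_concave3 (y := a) cf _ _ fx fb.
  + by rewrite xa ltW.
  + exact: le_lt_trans ab.
  by rewrite ea eb => le; rewrite -(ler_pM2l (x := b - a)) ?subr_gt0//; lra.
- have [| |_] := ln_concave3 (y := b) cf _ _ fa fx.
  + by rewrite bx ltW.
  + exact: lt_le_trans ab _.
  by rewrite ea eb => le; rewrite -(ler_pM2l (x := b - a)) ?subr_gt0//; lra.
Qed.

Lemma ln_concave_chord_in f a b p r x : ln_concave f -> a < b ->
  0 < f a -> 0 < f b -> ln (f a) = p * a + r -> ln (f b) = p * b + r ->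
  a <= x <= b -> 0 < f x /\ expR (p * x + r) <= f x.
Proof.
move=> cf ab fa fb ea eb xab.
have [fx le] := ln_concave3 cf xab ab fa fb; split=> //.
rewrite -ler_ln ?posrE ?expR_gt0// expRK.
by move: le; rewrite ea eb => le; rewrite -(ler_pM2l (x := b - a)) ?subr_gt0//; lra.
Qed.

(** Let l be the chord of ln f between two points with no datum strictly in
between. By concavity, min (f, e^l) equals e^l between the two points and f
elsewhere; it is log-concave as a minimum, and it agrees with f at the data. By
mle_minorant it has the mass of f, so f cannot exceed e^l anywhere. *)
Lemma mle_affine_gap f a b : is_log_concave_mle X f -> (0 < n)%N ->
  (forall i, 0 < f (X i)) ->
  a < b -> 0 < f a -> 0 < f b -> (forall i, X i <= a \/ b <= X i) ->
  exists p r, forall x, a <= x <= b -> f x = expR (p * x + r).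
Proof.
move=> mle n0 fX ab fa fb gap.
have [df lf uf] := mle.1; have [mf f0 _] := df.
have cf := log_concave_ln lf.
have ba0 : b - a != 0 by rewrite subr_eq0 gt_eqF.
pose p := (ln (f b) - ln (f a)) / (b - a); pose r := ln (f a) - p * a.
have ea : ln (f a) = p * a + r by rewrite /r; ring.
have eb : ln (f b) = p * b + r by rewrite /r /p; field.
have fin := ln_concave_chord_in cf ab fa fb ea eb.
have fout := ln_concave_chord_out cf ab fa fb ea eb.
exists p, r.
have cont_line : continuous (fun x : R => p * x + r).
  move=> x; apply: cvgD; last exact: cvg_cst.
  by apply: cvgM; [exact: cvg_cst|exact: cvg_id].
have cont_exp : continuous (fun x : R => expR (p * x + r)).
  move=> x; apply: (@continuous_comp R R R (fun x => p * x + r)).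
    exact: cont_line.
  exact: continuous_expR.
pose g x := Num.min (f x) (expR (p * x + r)).
have g0 x : 0 <= g x by rewrite le_min f0 expR_ge0.
have gf x : g x <= f x by rewrite ge_min lexx.
have gX i : g (X i) = f (X i) by rewrite /g min_l// fout.
have cg : ln_concave g.
  by apply: ln_concave_min => //; apply: ln_concave_expR => x y t t01; lra.
have ug : upper_semicontinuous g.
  by apply: usc_min => //; exact: continuous_usc.
have mg : measurable_fun setT g.
  by apply: measurable_minr => //; exact: continuous_measurable_fun.
have intf := density_integrable df.
have iint : mu.-integrable setT (EFin \o g).
  apply: le_integrable intf => //; first exact/measurable_EFinP.
  by move=> x _ /=; rewrite lee_fin ger0_norm// ger0_norm.
have [|_ int1] := mle_minorant mle n0 fX gX g0 gf mg cg ug.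
  apply: (Rintegral_gt0_itv iint g0 ab) => x /andP[ax xb].
  by have [|fx _] := fin x; rewrite ?lt_min ?expR_gt0 ?andbT// !ltW.
move=> c /andP[ac cb].
move: ac; rewrite le_eqVlt => /predU1P[<-|ac]; first by rewrite -ea lnK.
move: cb; rewrite le_eqVlt => /predU1P[->|cb]; first by rewrite -eb lnK.
have [|fc lec] := fin c; first by rewrite !ltW.
apply/eqP; rewrite eq_le lec andbT leNgt; apply/negP => ltc.
have ltc' : p * c + r < ln (f c) by rewrite -ltr_expR lnK.
(* Strict excess at c propagates by concavity to the whole gap. *)
suff : 0 < \int[mu]_x (f x - g x).
  by rewrite RintegralB// int1 density_Rintegral// subrr ltxx.
apply: (Rintegral_gt0_itv _ _ ab).
- exact: integrable_sub.
- by move=> x; rewrite subr_ge0.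
- move=> x /andP[ax xb]; rewrite subr_gt0 gt_min ltxx/=.
  have [|fx _] := fin x; first by rewrite !ltW.
  rewrite -[ltRHS]lnK ?posrE// ltr_expR.
  have [xc|cx] := leP x c.
    have [|_] := ln_concave3 (y := x) cf _ ac fa fc; first by rewrite xc ltW.
    rewrite ea => le; rewrite -(ltr_pM2l (x := c - a)) ?subr_gt0//.
    apply: lt_le_trans le.
    rewrite -subr_gt0 (_ : _ - _ = (x - a) * (ln (f c) - (p * c + r))); last ring.
    by rewrite mulr_gt0 ?subr_gt0.
  have [|_] := ln_concave3 (y := x) cf _ cb fc fb; first by rewrite !ltW.
  rewrite eb => le; rewrite -(ltr_pM2l (x := b - c)) ?subr_gt0//.
  apply: lt_le_trans le.
  rewrite -subr_gt0 (_ : _ - _ = (b - x) * (ln (f c) - (p * c + r))); last ring.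
  by rewrite mulr_gt0 ?subr_gt0.
Qed.
End Support.

(** * First-order optimality *)

(** As a function of x this is the integral over y <= z of the indicator of
x <= y, so its mean under a probability law is the integral up to z of the
distribution function of that law. *)
Definition hinge (R : realType) (z x : R) : R := Num.max (z - x) 0.

Section FirstOrder.
Context {R : realType} (n : nat) (X : 'I_n -> R).
Local Notation mu := (@lebesgue_measure R).
Implicit Types (f g d : R -> R) (a b x y z p : R).

Lemma expR_quadratic_ub (y : R) : `|y| <= 2^-1 -> expR y <= 1 + y + 2 * y ^+ 2.
Proof.
rewrite ler_norml => /andP[y0 y1].
have h := expR_ge1Dx (- y); have e0 := expR_gt0 y.
have : (1 - y) * expR y <= 1.
  by rewrite -[leRHS](expRxMexpNx_1 y) mulrC ler_pM2l.
have : 0 < 1 - y by lra.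
move=> y2 le; rewrite -(ler_pM2l y2); apply: le_trans le _; nra.
Qed.

(** The factor need only be bounded where f does not vanish: hinges are
unbounded, but are multiplied by densities of bounded support. *)
Lemma integrable_mul_bounded f d (B : R) (D : set (measurableTypeR R)) :
  measurable D -> mu.-integrable D (EFin \o f) -> measurable_fun setT d ->
  (forall x, D x -> f x != 0 -> `|d x| <= B) ->
  mu.-integrable D (EFin \o fun x => f x * d x).
Proof.
move=> mD intf md dB.
apply: (le_integrable mD _ _ (integrableZl mD B intf)).
  apply/measurable_EFinP; apply: measurable_funM.
    by apply/measurable_EFinP; exact: (measurable_int _ intf).
  exact: measurable_funS md.
move=> x Dx; rewrite /= lee_fin !normrM mulrC.
have [->|fx] := eqVneq (f x) 0; first by rewrite normr0 !mulr0.
by rewrite ler_wpM2r// (le_trans (dB x Dx fx))// ler_norm.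
Qed.

(** First-order optimality: the derivative at 0 of the log-likelihood of
f e^(tau d), normalised, is (1/n) sum d(X_i) - int f d. *)
Lemma mle_first_order f d (B tau0 : R) : is_log_concave_mle X f ->
  (0 < n)%N -> (forall i, 0 < f (X i)) -> continuous d ->
  (forall x, f x != 0 -> `|d x| <= B) -> 0 < tau0 ->
  (forall tau, 0 < tau <= tau0 -> ln_concave (fun x => f x * expR (tau * d x))) ->
  \sum_(i < n) d (X i) <= n%:R * \int[mu]_x (f x * d x).
Proof.
move=> mle n0 fX cd dB tau00 ctau.
have [df lf uf] := mle.1; have [mf f0 _] := df.
have intf := density_integrable df.
have n0r : 0 < n%:R :> R by rewrite ltr0n.
have md : measurable_fun setT d by exact: continuous_measurable_fun.
have B0 : 0 <= B.
  by apply: le_trans (dB (X (Ordinal n0)) _) => //; rewrite gt_eqF.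
have intfd := integrable_mul_bounded measurableT intf md (fun x _ => @dB x).
apply/ler_addgt0Pr => e e0.
(* tau B <= 1/2 gives access to the quadratic bound on e^(tau d); the second
   order term 2 n tau^2 B^2 is then at most tau e. *)
pose tau := Num.min tau0 (Num.min (2^-1 / (B + 1)) (e / (2 * n%:R * (B ^+ 2 + 1)))).
have B1 : 0 < B + 1 by lra.
have B2 : 0 < B ^+ 2 + 1 by rewrite ltr_wpDl// sqr_ge0.
have tau_gt0 : 0 < tau.
  by rewrite !lt_min tau00 !divr_gt0// mulr_gt0// mulr_gt0.
have tau_le0 : tau <= tau0 by rewrite ge_min lexx.
have tauB : tau * B <= 2^-1.
  have : tau <= 2^-1 / (B + 1) by rewrite !ge_min lexx ?orbT.
  by rewrite ler_pdivlMr//; nra.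
have taue : 2 * n%:R * tau * B ^+ 2 <= e.
  have : tau <= e / (2 * n%:R * (B ^+ 2 + 1)) by rewrite !ge_min lexx ?orbT.
  rewrite ler_pdivlMr; last by rewrite mulr_gt0// mulr_gt0.
  have := mulr_gt0 tau_gt0 n0r; nra.
have tdB x : f x != 0 -> `|tau * d x| <= 2^-1.
  by move=> /dB dx; rewrite normrM gtr0_norm//; nra.
pose g x := f x * expR (tau * d x).
have g0 x : 0 <= g x by rewrite mulr_ge0// expR_ge0.
have ctd : continuous (fun x => tau * d x).
  by move=> x; apply: cvgM; [exact: cvg_cst|exact: cd].
have cetd : continuous (fun x => expR (tau * d x)).
  by move=> x; apply: (@continuous_comp R R R (fun x => tau * d x));
    [exact: ctd|exact: continuous_expR].
have intg : mu.-integrable setT (EFin \o g).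
  apply: (integrable_mul_bounded (B := expR 2^-1)) => //.
    exact: continuous_measurable_fun.
  move=> x _ /tdB; rewrite ler_norml => /andP[_ le].
  by rewrite ger0_norm ?expR_ge0// ler_expR.
have gub x : g x <= f x + tau * (f x * d x) + (2 * tau ^+ 2 * B ^+ 2) * f x.
  have [fx|fx] := eqVneq (f x) 0; first by rewrite /g fx !(mul0r, mulr0) !addr0.
  have := expR_quadratic_ub (tdB x fx).
  have : d x ^+ 2 <= B ^+ 2 by rewrite -[d x ^+ 2]real_normK ?num_real// lerXn2r ?nnegrE// dB.
  move=> dB2 le; rewrite /g.
  have -> : f x + tau * (f x * d x) + 2 * tau ^+ 2 * B ^+ 2 * f x =
    f x * (1 + tau * d x + 2 * (tau ^+ 2 * B ^+ 2)) by ring.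
  rewrite ler_wpM2l//; apply: le_trans le _.
  by rewrite lerD2l ler_wpM2l// exprMn ler_wpM2l// sqr_ge0.
have glb x : expR (- 2^-1) * f x <= g x.
  have [fx|fx] := eqVneq (f x) 0; first by rewrite /g fx mulr0 mul0r.
  rewrite /g mulrC ler_wpM2l// ler_expR.
  by have := tdB x fx; rewrite ler_norml => /andP[].
have f1 := density_Rintegral df.
have intZ (h : R -> R) c : mu.-integrable setT (EFin \o h) ->
    mu.-integrable setT (EFin \o fun x => c * h x).
  by move=> inth; exact: integrable_scale.
have N0 : 0 < \int[mu]_x g x.
  apply: (@lt_le_trans _ _ (\int[mu]_x (expR (- 2^-1) * f x))).
    by rewrite RintegralZl// f1 mulr1 expR_gt0.
  by apply: le_Rintegral => //; exact: intZ.
have intS : mu.-integrable setT (EFin \o fun x => f x + tau * (f x * d x)).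
  by apply: integrable_add => //; exact: intZ.
have Nub : \int[mu]_x g x <=
    1 + tau * \int[mu]_x (f x * d x) + 2 * tau ^+ 2 * B ^+ 2.
  have intB := intZ f (2 * tau ^+ 2 * B ^+ 2) intf.
  have <- : \int[mu]_x (f x + tau * (f x * d x) + 2 * tau ^+ 2 * B ^+ 2 * f x)
      = 1 + tau * \int[mu]_x (f x * d x) + 2 * tau ^+ 2 * B ^+ 2.
    by rewrite RintegralD// RintegralD ?RintegralZl ?f1 ?mulr1//; exact: intZ.
  apply: le_Rintegral => //.
  by apply: integrable_add => //; exact: intZ.
have gX i : 0 < g (X i) by rewrite mulr_gt0// expR_gt0.
have tau_itv : 0 < tau <= tau0 by rewrite tau_gt0.
have := mle_competitor mle g0 (ctau _ tau_itv) (uscM_expR uf ctd) intg N0 gX.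
rewrite log_likelihoodE// lee_fin -/g.
under eq_bigr => i _ do rewrite lnM ?posrE ?expR_gt0// expRK.
rewrite big_split/= -addrA gerDl subr_le0 -mulr_sumr => le.
have lnN : ln (\int[mu]_x g x) <= \int[mu]_x g x - 1.
  by have := @le_ln1Dx R (\int[mu]_x g x - 1); rewrite [1 + _]addrC subrK; apply; lra.
rewrite -(ler_pM2l tau_gt0); apply: le_trans le _.
have {lnN}Nub := le_trans lnN (lerB Nub (lexx 1)).
have := ler_wpM2l (ltW n0r) Nub => /le_trans; apply.
have := mulr_gt0 tau_gt0 e0 => te.
have := ler_wpM2l (ltW tau_gt0) taue.
lra.
Qed.

End FirstOrder.

(** * Hinge perturbations and kinks *)

Section Hinges.
Context {R : realType} (n : nat) (X : 'I_n -> R).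
Local Notation mu := (@lebesgue_measure R).
Implicit Types (f g d : R -> R) (a b x y z p : R).

Lemma hinge_le z x : x <= z -> hinge z x = z - x.
Proof. by move=> xz; rewrite /hinge max_l// subr_ge0. Qed.

Lemma hinge_ge z x : z <= x -> hinge z x = 0.
Proof. by move=> zx; rewrite /hinge max_r// subr_le0. Qed.

Lemma hinge_ge0 z x : 0 <= hinge z x.
Proof. by rewrite le_max lexx orbT. Qed.

Lemma continuous_hinge z : continuous (hinge z).
Proof.
move=> x; apply: (@continuous_max _ _ (fun x => z - x) (fun=> 0)).
  by apply: cvgB; [exact: cvg_cst|exact: cvg_id].
exact: cvg_cst.
Qed.

Lemma hinge_convex z x y t : 0 <= t <= 1 ->
  hinge z (t * x + (1 - t) * y) <= t * hinge z x + (1 - t) * hinge z y.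
Proof.
move=> /andP[t0 t1]; rewrite {1}/hinge ge_max; apply/andP; split.
  have hx : z - x <= hinge z x by rewrite le_max lexx.
  have hy : z - y <= hinge z y by rewrite le_max lexx.
  have := ler_wpM2l t0 hx.
  have t1' : 0 <= 1 - t by rewrite subr_ge0.
  by have := ler_wpM2l t1' hy; lra.
by rewrite addr_ge0// mulr_ge0 ?hinge_ge0// subr_ge0.
Qed.

Lemma hinge_bound z a b x : a <= x <= b -> `|hinge z x| <= `|z| + `|a|.
Proof.
move=> /andP[ax _]; rewrite ger0_norm ?hinge_ge0// ge_max.
rewrite addr_ge0 ?normr_ge0// andbT.
by have := ler_norm z; have := ler_norm (- a); rewrite normrN; lra.
Qed.

Lemma ramp_le s u x : s <= u -> hinge u x - hinge s x <= (u - s) * (x <= u)%R%:R.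
Proof.
move=> su; have [xu|ux] := leP x u; last first.
  by rewrite !hinge_ge ?(ltW ux)// ?subrr ?mulr0// (le_trans su)// ltW.
rewrite mulr1 (hinge_le xu).
by have [xs|sx] := leP x s; [rewrite hinge_le//|rewrite hinge_ge ?(ltW sx)//]; lra.
Qed.

Lemma ramp_ge s u x : s <= u -> (u - s) * (x <= s)%R%:R <= hinge u x - hinge s x.
Proof.
move=> su; have [xs|sx] := leP x s.
  by rewrite mulr1 !hinge_le ?(le_trans xs)//; lra.
by rewrite mulr0 (hinge_ge (ltW sx)) subr0 hinge_ge0.
Qed.

(** At a kink z of ln f, with two supporting slopes p' < p, a small multiple
of the hinge at z can be added to ln f without destroying concavity. *)
Lemma ln_concave_kink f z p p' tau : ln_concave f -> (forall x, 0 <= f x) ->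
  0 < f z -> p' < p ->
  (forall x, f x <= f z * expR (p * (x - z))) ->
  (forall x, f x <= f z * expR (p' * (x - z))) ->
  0 < tau <= p - p' -> ln_concave (fun x => f x * expR (tau * hinge z x)).
Proof.
move=> cf f0 fz pp' supp supp' /andP[tau0 taup].
apply: ln_concave_from3 => x y w /andP[xy yw] /=.
rewrite !pmulr_lgt0 ?expR_gt0// => fx fw.
have lnsupp q u : (forall x, f x <= f z * expR (q * (x - z))) -> 0 < f u ->
    ln (f u) <= ln (f z) + q * (u - z).
  move=> sq fu; rewrite -[X in _ + X]expRK -lnM ?posrE ?expR_gt0//.
  by rewrite ler_ln ?posrE ?mulr_gt0 ?expR_gt0.
have xw := lt_trans xy yw.
have [|fy le] := ln_concave3 (y := y) cf _ xw fx fw; first by rewrite !ltW.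
split=> //; rewrite !lnM ?posrE ?expR_gt0// !expRK.
have [wz|zw] := leP w z.
  rewrite !hinge_le//; [lra|lra|lra].
have [zx|xz] := leP z x.
  rewrite !hinge_ge//; [lra|lra|lra].
have A := lnsupp p x supp fx; have A' := lnsupp p' w supp' fw.
rewrite (hinge_le (ltW xz)) (hinge_ge (ltW zw)).
(* On both sides of z the modified function lies below the line of slope p'
   through its value at z, so its chord from x to w passes below that value. *)
have key : (w - z) * (ln (f x) - ln (f z) + tau * (z - x)) +
    (z - x) * (ln (f w) - ln (f z)) <= 0.
  have zx0 : 0 < z - x by rewrite subr_gt0.
  have wz0 : 0 < w - z by rewrite subr_gt0.
  have h1 : ln (f x) - ln (f z) + tau * (z - x) <= - p' * (z - x).
    by have := ler_wpM2r (ltW zx0) taup; lra.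
  have h2 : ln (f w) - ln (f z) <= p' * (w - z) by lra.
  have := ler_wpM2l (ltW wz0) h1; have := ler_wpM2l (ltW zx0) h2; lra.
have [yz|zy] := leP y z.
  rewrite (hinge_le yz).
  have [|_ le1] := ln_concave3 (y := y) cf _ xz fx fz; first by rewrite yz ltW.
  have zx0 : 0 < z - x by rewrite subr_gt0.
  have wx0 : 0 < w - x by rewrite subr_gt0.
  have yx0 : 0 <= y - x by rewrite subr_ge0 ltW.
  rewrite -(ler_pM2l zx0).
  have := ler_wpM2l (ltW wx0) le1; have := ler_wpM2l yx0 key; lra.
rewrite (hinge_ge (ltW zy)).
have [|_ le1] := ln_concave3 (y := y) cf _ zw fz fw; first by rewrite !ltW.
have wz0 : 0 < w - z by rewrite subr_gt0.
have wx0 : 0 < w - x by rewrite subr_gt0.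
have wy0 : 0 <= w - y by rewrite subr_ge0 ltW.
rewrite -(ler_pM2l wz0).
have := ler_wpM2l (ltW wx0) le1; have := ler_wpM2l wy0 key; lra.
Qed.

Section Support.
Context (f : R -> R) (a b : R).
Hypotheses (mle : is_log_concave_mle X f) (n0 : (0 < n)%N)
  (fX : forall i, 0 < f (X i)) (fab : forall x, f x != 0 -> a <= x <= b).

(** Equality at z of the integrals up to z of the empirical distribution
function and of the one of f. *)
Definition balanced z : Prop :=
  \sum_(i < n) hinge z (X i) = n%:R * \int[mu]_x (f x * hinge z x).

Let cf := log_concave_ln (let: And3 _ lf _ := mle.1 in lf).

(** The opposite of a hinge is concave, hence always an admissible direction
of perturbation of ln f. *)
Lemma mle_hinge_le z :
  n%:R * \int[mu]_x (f x * hinge z x) <= \sum_(i < n) hinge z (X i).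
Proof.
have [df lf uf] := mle.1.
have intf := density_integrable df.
have := @mle_first_order _ _ X f (fun x => - hinge z x) (`|z| + `|a|) 1 mle n0 fX.
have -> : \int[mu]_x (f x * - hinge z x) = - \int[mu]_x (f x * hinge z x).
  rewrite -mulN1r -RintegralZl//; first by apply: eq_Rintegral => x _; ring.
  apply: (integrable_mul_bounded (B := `|z| + `|a|)) => //.
    by apply: continuous_measurable_fun; exact: continuous_hinge.
  by move=> x _ /fab; exact: hinge_bound.
rewrite sumrN mulrN lerN2; apply=> //.
- by move=> x; apply: cvgN; exact: continuous_hinge.
- by move=> x /fab xab; rewrite normrN; exact: hinge_bound xab.
- move=> tau /andP[tau0 _]; apply: ln_concaveM_expR => // x y t t01.
  by have := ler_wpM2l (ltW tau0) (hinge_convex z x y t01); lra.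
Qed.

(** At a kink of ln f the hinge is an admissible direction as well as its
opposite, so that the first-order condition becomes an equality. *)
Lemma mle_kink z p p' : 0 < f z -> p' < p ->
  (forall x, f x <= f z * expR (p * (x - z))) ->
  (forall x, f x <= f z * expR (p' * (x - z))) -> balanced z.
Proof.
move=> fz pp' supp supp'.
apply/eqP; rewrite eq_le mle_hinge_le andbT.
have f0 x : 0 <= f x by case: mle.1 => -[].
apply: (@mle_first_order _ _ X f (hinge z) (`|z| + `|a|) (p - p')) => //.
- exact: continuous_hinge.
- by move=> x /fab; exact: hinge_bound.
- by rewrite subr_gt0.
- by move=> tau; exact: ln_concave_kink.
Qed.

End Support.
End Hinges.

(** * Affine cells with balanced ends *)

Section AffineCells.
Context {R : realType} (n : nat) (X : 'I_n -> R).
Implicit Types (f : R -> R) (a b x y z p : R).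

Lemma next_datum x : (exists i, x < X i) ->
  exists i, x < X i /\ forall j, X j <= x \/ X i <= X j.
Proof.
move=> [i0 xi0]; case: (@arg_minP _ _ _ i0 (fun i => x < X i) X xi0) => i xi imin.
by exists i; split=> // j; have [|/imin] := leP (X j) x; [left|right].
Qed.

Lemma previous_datum x : (exists i, X i < x) ->
  exists i, X i < x /\ forall j, X j <= X i \/ x <= X j.
Proof.
move=> [i0 xi0]; case: (@arg_maxP _ _ _ i0 (fun i => X i < x) X xi0) => i xi imax.
by exists i; split=> // j; have [|/imax] := leP x (X j); [right|left].
Qed.

Context (f : R -> R) (a b : R).
Hypotheses (mle : is_log_concave_mle X f) (n0 : (0 < n)%N)
  (fX : forall i, 0 < f (X i)) (fab : forall x, f x != 0 -> a <= x <= b).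
Hypotheses (ab : a < b) (Xa : exists i, X i = a) (Xb : exists i, X i = b).

Let cf := log_concave_ln (let: And3 _ lf _ := mle.1 in lf).

Let f0 x : 0 <= f x.
Proof. by case: mle.1 => -[]. Qed.

Let Xab i : a <= X i <= b.
Proof. by apply: fab; rewrite gt_eqF. Qed.

Lemma affine_gap_support u v : u < v -> 0 < f u -> 0 < f v ->
  (forall i, X i <= u \/ v <= X i) ->
  exists p r, (forall x, u <= x <= v -> f x = expR (p * x + r)) /\
    forall x, f x <= expR (p * x + r).
Proof.
move=> uv fu fv gap; have [p [r aff]] := mle_affine_gap mle n0 fX uv fu fv gap.
exists p, r; split=> // x.
have affln y : u <= y <= v -> ln (f y) = p * y + r by move=> /aff ->; rewrite expRK.
have [eu ev] : ln (f u) = p * u + r /\ ln (f v) = p * v + r.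
  by split; apply: affln; rewrite lexx ltW.
have [ux|xu] := leP u x; last first.
  by apply: (ln_concave_chord_out cf uv) => //; left; exact: ltW.
have [xv|vx] := leP x v; first by rewrite aff ?ux.
by apply: (ln_concave_chord_out cf uv) => //; right; exact: ltW.
Qed.

(** The line through the gap around x touches ln f on an interval. The outermost
data points s and t on that line bound it: past t, either f vanishes or the next
gap has a strictly smaller slope, so there are two supporting slopes at t, which
makes t balanced; and symmetrically at s. *)
Lemma mle_affine_cell x : a <= x <= b ->
  exists s t p r, [/\ a <= s /\ t <= b, s < t, s <= x <= t,
    balanced X f s /\ balanced X f t &
    forall y, s <= y <= t -> f y = expR (p * y + r)].
Proof.
move=> /andP[ax xb].
have [ia Xia] := Xa; have [ib Xib] := Xb.
have [i [j [ij xij gap]]] : exists i j, [/\ X i < X j, X i <= x <= X j &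
    forall k, X k <= X i \/ X j <= X k].
  have [xltb|bx] := ltP x b.
    have [|j [xj jmin]] := @next_datum x; first by exists ib; rewrite Xib.
    have [|i [ij imax]] := @previous_datum (X j).
      by exists ia; rewrite Xia (le_lt_trans ax).
    exists i, j; split=> //; rewrite (ltW xj) andbT.
    by case: (jmin i) => // /(lt_le_trans ij); rewrite ltxx.
  have [|i [ij imax]] := @previous_datum b; first by exists ia; rewrite Xia.
  exists i, ib; rewrite Xib; split=> //.
  by rewrite xb andbT (le_trans (ltW ij)).
have [p [r [aff supp]]] := affine_gap_support ij (fX i) (fX j) gap.
pose Z k := f (X k) == expR (p * X k + r).
have Zi : Z i by rewrite /Z aff// lexx ltW.
have Zj : Z j by rewrite /Z aff// lexx ltW.
case: (@arg_maxP _ _ _ j Z X Zj) => kt /eqP Zt tmax.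
case: (@arg_minP _ _ _ i Z X Zi) => ks /eqP Zs smin.
have si : X ks <= X i by exact: smin.
have jt : X j <= X kt by exact: tmax.
have st : X ks < X kt by rewrite (le_lt_trans si)// (lt_le_trans ij).
have es : ln (f (X ks)) = p * X ks + r by rewrite Zs expRK.
have et : ln (f (X kt)) = p * X kt + r by rewrite Zt expRK.
have affst y : X ks <= y <= X kt -> f y = expR (p * y + r).
  move=> yst; apply/eqP; rewrite eq_le supp/=.
  by have [] := ln_concave_chord_in cf st (fX ks) (fX kt) es et yst.
have rebase q r' z y : f z = expR (q * z + r') ->
    expR (q * y + r') = f z * expR (q * (y - z)).
  by move=> ->; rewrite -expRD; congr expR; ring.
have suppt y : f y <= f (X kt) * expR (p * (y - X kt)) by rewrite -(rebase p r).
have supps y : f y <= f (X ks) * expR (p * (y - X ks)) by rewrite -(rebase p r).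
have strict k : ~~ Z k -> f (X k) < expR (p * X k + r).
  by rewrite lt_neqAle supp andbT.
exists (X ks), (X kt), p, r; split=> //.
- by have /andP[? _] := Xab ks; have /andP[_ ?] := Xab kt.
- by move/andP: xij => [ix xj]; rewrite (le_trans si)// (le_trans xj).
split.
- have [aks|aks] := ltP a (X ks).
    have [|k [ks_k gapk]] := @previous_datum (X ks); first by exists ia; rewrite Xia.
    have [p2 [r2 [aff2 supp2]]] := affine_gap_support ks_k (fX k) (fX ks) gapk.
    have e2 : f (X ks) = expR (p2 * X ks + r2) by rewrite aff2// lexx ltW.
    apply: (@mle_kink _ _ _ f a b _ _ _ _ (X ks) p2 p) => // [|y].
      have : ~~ Z k by apply/negP => /smin /(lt_le_trans ks_k); rewrite ltxx.
      move/strict; rewrite (rebase p r (X ks))// (aff2 (X k)) ?lexx ?ltW//.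
      rewrite (rebase p2 r2 (X ks))// ltr_pM2l// ltr_expR.
      by rewrite -subr_gt0 -mulrBl nmulr_lgt0 ?subr_lt0.
    by rewrite -(rebase p2 r2).
  (* As f vanishes left of a, any larger slope supports ln f at a. *)
  apply: (@mle_kink _ _ _ f a b _ _ _ _ (X ks) (p + 1) p) => // [|y].
    by rewrite ltrDl.
  have [->|/fab /andP[ay _]] := eqVneq (f y) 0.
    by rewrite mulr_ge0// expR_ge0.
  apply: le_trans (supps y) _; rewrite ler_pM2l// ler_expR.
  by rewrite mulrDl lerDl mul1r subr_ge0 (le_trans aks).
- have [ktb|ktb] := ltP (X kt) b.
    have [|k [kt_k gapk]] := @next_datum (X kt); first by exists ib; rewrite Xib.
    have [p2 [r2 [aff2 supp2]]] := affine_gap_support kt_k (fX kt) (fX k) gapk.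
    have e2 : f (X kt) = expR (p2 * X kt + r2) by rewrite aff2// lexx ltW.
    apply: (@mle_kink _ _ _ f a b _ _ _ _ (X kt) p p2) => // [|y].
      have : ~~ Z k by apply/negP => /tmax /(lt_le_trans kt_k); rewrite ltxx.
      move/strict; rewrite (rebase p r (X kt))// (aff2 (X k)) ?lexx ?ltW//.
      rewrite (rebase p2 r2 (X kt))// ltr_pM2l// ltr_expR.
      by rewrite -subr_gt0 -mulrBl pmulr_lgt0 ?subr_gt0.
    by rewrite -(rebase p2 r2).
  apply: (@mle_kink _ _ _ f a b _ _ _ _ (X kt) p (p - 1)) => // [|y].
    by rewrite ltrBlDr ltrDl.
  have [->|/fab /andP[_ yb]] := eqVneq (f y) 0.
    by rewrite mulr_ge0// expR_ge0.
  apply: le_trans (suppt y) _; rewrite ler_pM2l// ler_expR.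
  by rewrite mulrBl lerBrDr gerDl mul1r subr_le0 (le_trans yb).
Qed.

End AffineCells.

(** * Distribution functions and ramps *)

Section DistributionFunctions.
Context {R : realType}.
Local Notation mu := (@lebesgue_measure R).
Implicit Types (f : R -> R) (s t u x y : R).

Lemma density_itv f (D : set (measurableTypeR R)) : measurable D -> is_density f ->
  mu.-integrable D (EFin \o f).
Proof. by move=> mD /density_integrable; exact: integrableS. Qed.

Lemma df_sub f x y : is_density f -> x <= y ->
  distribution_function f y - distribution_function f x =
  \int[mu]_(t in `[x, y]) f t.
Proof.
move=> df xy; rewrite /distribution_function Rintegral_itvB ?bnd_simp//.
  by rewrite Rintegral_itv_obnd_cbnd//; exact: density_itv.
exact: density_itv.
Qed.

Lemma df_continuous f s t : is_density f -> s <= t ->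
  {within `[s, t], continuous (distribution_function f)}.
Proof.
move=> df st.
have := parameterized_integral_continuous st (density_itv (measurable_itv `[s, t]) df).
move=> c; apply: (@subspace_eq_continuous _ _ _
    (fun x => distribution_function f s + \int[mu]_(t in `[s, x]) f t)).
  move=> x; rewrite inE /= in_itv/= => /andP[sx _].
  by rewrite -(df_sub df sx) addrC subrK.
by move=> x; apply: cvgD; [exact: cvg_cst|exact: c].
Qed.

Lemma df_itv f x : is_density f -> 0 <= distribution_function f x <= 1.
Proof.
move=> df; have [mf f0 _] := df; apply/andP; split.
  by apply: Rintegral_ge0 => y _.
rewrite -(density_Rintegral df) /distribution_function.
rewrite Rintegral_mkcond; apply: le_Rintegral => //.
- rewrite -restrict_EFin; apply/integrable_restrict => //; rewrite ?setTI//.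
  exact: density_itv.
- exact: density_integrable.
- by move=> y _; rewrite patchE; case: ifP.
Qed.

(** Layer-cake formula for hinge u - hinge s, the ramp which is u - s up to s
and decreases to 0 on [s, u]. *)
Lemma hinge_layers s u r : s <= u ->
  mu.-integrable setT (EFin \o fun x => ((s <= x <= u) && (r <= x))%R%:R) /\
  \int[mu]_x ((s <= x <= u) && (r <= x))%R%:R = hinge u r - hinge s r.
Proof.
move=> su; have [ru|ur] := leP r u; last first.
  have -> : (fun x => ((s <= x <= u) && (r <= x))%R%:R) = (fun=> 0) :> (R -> R).
    apply/funext => x; have [rx|_] := leP r x; rewrite ?andbF//.
    by rewrite (leNgt x) (lt_le_trans ur rx) andbF.
  rewrite !hinge_ge ?(ltW ur)//; last by rewrite (le_trans su)// ltW.
  by rewrite subrr Rintegral_cst// mul0r; split=> //; exact: integrable0.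
have sr : Num.max s r <= u by rewrite ge_max su.
have -> : (fun x => ((s <= x <= u) && (r <= x))%R%:R) =
    (fun x => (Num.max s r <= x <= u)%R%:R) :> (R -> R).
  apply/funext => x; rewrite ge_max.
  by case: (s <= x); case: (r <= x); case: (x <= u).
have [int_max ->] := Rintegral_itv_indic sr; split=> //.
rewrite (hinge_le ru).
have [rs|sr'] := leP r s; first by rewrite hinge_le//; ring.
by rewrite hinge_ge ?(ltW sr')// subr0.
Qed.

(** Tonelli, applied to the layers of the ramp. *)
Lemma df_integral f s u : is_density f -> s <= u ->
  \int[mu]_(x in `[s, u]) distribution_function f x =
  \int[mu]_x (f x * (hinge u x - hinge s x)).
Proof.
move=> df su; have [mf f0 _] := df.
pose h (p : R * R) : \bar R :=
  (if (s <= p.1 <= u) && (p.2 <= p.1) then f p.2 else 0)%:E.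
have mh : measurable_fun setT h.
  apply/measurable_EFinP; apply: measurable_fun_ifT => //.
    apply: measurable_and; first apply: measurable_and.
    - exact: measurable_fun_ler.
    - exact: measurable_fun_ler.
    - exact: measurable_fun_ler.
  exact: measurableT_comp.
have h0 p : (0 <= h p)%E by rewrite lee_fin; case: ifP.
have := @fubini_tonelli _ _ _ _ R mu mu h mh h0.
rewrite /h /=.
have -> : (\int[mu]_x \int[mu]_y (if (s <= x <= u) && (y <= x) then f y else 0)%:E
  = \int[mu]_(x in `[s, u]) (distribution_function f x)%:E)%E.
  rewrite [RHS]integral_mkcond; apply: eq_integral => x _.
  rewrite patchE mem_setE in_itv/=; case: ifP => _ /=; last first.
    by rewrite integral0.
  rewrite /distribution_function /Rintegral fineK; last first.
    by apply: integrable_fin_num => //; exact: density_itv.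
  rewrite [RHS]integral_mkcond; apply: eq_integral => y _.
  by rewrite patchE mem_setE in_itv/=; case: ifP.
have -> : (\int[mu]_y \int[mu]_x (if (s <= x <= u) && (y <= x) then f y else 0)%:E
  = \int[mu]_y (f y * (hinge u y - hinge s y))%:E)%E.
  apply: eq_integral => y _.
  have [intl <-] := hinge_layers y su.
  rewrite -RintegralZl// /Rintegral fineK.
    by apply: eq_integral => x _; case: ifP; rewrite ?mulr1 ?mulr0.
  by apply: integrable_fin_num => //; exact: integrable_scale.
by move=> e; rewrite /Rintegral e.
Qed.

(** Read with df_integral, this integrates the distribution function by parts
over [s, u]. *)
Lemma density_ramp_integral f s u : is_density f -> s <= u ->
  \int[mu]_x (f x * (hinge u x - hinge s x)) =
  (u - s) * distribution_function f s + \int[mu]_(x in `[s, u]) (f x * (u - x)).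
Proof.
move=> df su.
have m1 : measurable (`]-oo, s]%classic : set (measurableTypeR R)) by exact: measurable_itv.
have m2 : measurable (`]s, u]%classic : set (measurableTypeR R)) by exact: measurable_itv.
have m3 : measurable (`[s, u]%classic : set (measurableTypeR R)) by exact: measurable_itv.
have intr : mu.-integrable `[s, u] (EFin \o fun x => f x * (u - x)).
  apply: (integrable_mul_bounded (B := u - s)) => //.
  - exact: density_itv.
  - by apply: measurable_funB.
  - move=> x; rewrite /= in_itv/= => /andP[sx xu] _.
    by rewrite ger0_norm ?subr_ge0// lerB.
have intr' : mu.-integrable `]s, u] (EFin \o fun x => f x * (u - x)).
  by apply: integrableS intr => //; exact: subset_itv_oc_cc.
rewrite -(Rintegral_itv_obnd_cbnd intr') /distribution_function.
rewrite [X in _ * X]Rintegral_mkcond [X in _ + X]Rintegral_mkcond.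
have i1 : mu.-integrable setT (EFin \o (f \_ `]-oo, s])).
  rewrite -restrict_EFin; apply/integrable_restrict => //; rewrite setTI.
  exact: density_itv.
have i2 : mu.-integrable setT (EFin \o ((fun x => f x * (u - x)) \_ `]s, u])).
  by rewrite -restrict_EFin; apply/integrable_restrict => //; rewrite setTI.
rewrite -RintegralZl// -RintegralD//; last exact: integrable_scale.
have p0 : point = 0 :> R by [].
apply: eq_Rintegral => x _; rewrite !patchE !mem_setE !in_itv/= !p0.
have [xs|sx] := leP x s.
  by rewrite !hinge_le ?(le_trans xs)//=; ring.
rewrite (hinge_ge (ltW sx)); have [xu|ux] := leP x u.
  by rewrite hinge_le//=; ring.
by rewrite hinge_ge ?(ltW ux)//=; ring.
Qed.

Lemma empirical_integral n (X : 'I_n -> R) s u : s <= u ->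
  mu.-integrable `[s, u] (EFin \o empirical_df X) /\
  \int[mu]_(x in `[s, u]) empirical_df X x =
  n%:R^-1 * \sum_(i < n) (hinge u (X i) - hinge s (X i)).
Proof.
move=> su.
pose l i x : R := ((s <= x <= u) && (X i <= x))%R%:R.
have intl i : mu.-integrable setT (EFin \o l i) by have [] := hinge_layers (X i) su.
have intsum : mu.-integrable setT (EFin \o fun x => \sum_(i < n) l i x).
  have := @integrable_sum _ _ _ mu setT measurableT _ (index_enum 'I_n) predT
    (fun i => EFin \o l i) (fun i _ => intl i).
  by apply: eq_integrable => // x _; rewrite /= sumEFin.
have E : empirical_df X \_ `[s, u] = fun x => n%:R^-1 * \sum_(i < n) l i x.
  apply/funext => x; rewrite patchE mem_setE in_itv/= /empirical_df /l.
  by case: ifP => //= _; rewrite big1 ?mulr0.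
split.
  have := integrable_scale n%:R^-1 measurableT intsum; rewrite -E -restrict_EFin.
  by move/integrable_restrict; rewrite setTI; apply.
rewrite Rintegral_mkcond E RintegralZl//; congr (_ * _).
rewrite {1}/Rintegral; under eq_integral do rewrite -sumEFin.
rewrite integral_sum//=.
under eq_bigr => i _.
  rewrite -[integral _ _ _]fineK; last exact: integrable_fin_num (intl i).
  rewrite -/(Rintegral _ _ _) (hinge_layers (X i) su).2.
  over.
by rewrite sumEFin.
Qed.

(** The means of a ramp under two laws differ by the integral over [s, u] of
the difference of the distribution functions. *)
Lemma empirical_df_bound n (X : 'I_n -> R) f s u delta : is_density f -> s <= u ->
  (forall x, `|empirical_df X x - distribution_function f x| <= delta) ->
  `|n%:R^-1 * \sum_(i < n) (hinge u (X i) - hinge s (X i))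
    - \int[mu]_x (f x * (hinge u x - hinge s x))| <= delta * (u - s).
Proof.
move=> df su le.
have [inte <-] := empirical_integral X su; rewrite -df_integral//.
have intF : mu.-integrable `[s, u] (EFin \o distribution_function f).
  apply: continuous_compact_integrable; first exact: segment_compact.
  exact: df_continuous.
have intc (c : R) : mu.-integrable `[s, u] (EFin \o fun=> c).
  apply: continuous_compact_integrable; first exact: segment_compact.
  by move=> x; exact: cvg_cst.
rewrite -RintegralB//.
have <- : forall c : R, \int[mu]_(x in `[s, u]) c = c * (u - s).
  move=> c; rewrite Rintegral_cst//= lebesgue_measure_itv/= lte_fin.
  by case: ltgtP su => // -> _; rewrite subrr.
apply: le_trans (le_normr_Rintegral _ _) _ => //; first exact: integrable_sub.
apply: le_Rintegral => //.
by have := integrable_norm (integrable_sub _ inte intF); apply.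
Qed.

End DistributionFunctions.

(** * The function q *)

Section Q.
Context {R : realType}.
Local Notation mu := (@lebesgue_measure R).
Implicit Types (f : R -> R) (s t u x y k : R).

Lemma gt0_derive_gt0 (f f' : R -> R) : (forall x, is_derive x 1 f (f' x)) ->
  f 0 = 0 -> (forall x, 0 < x -> 0 < f' x) -> forall x, 0 < x -> 0 < f x.
Proof.
move=> df f0 f'0 x x0; rewrite -f0.
apply: (@gtr0_derive1_incr _ f 0 x) => //.
- by move=> y; rewrite in_itv/= => /andP[y0 _]; rewrite derive1E derive_val f'0.
- apply: derivable_within_continuous => y _; exact: ex_derive.
Qed.

Lemma expR_sub1_gt0 x : 0 < x -> 0 < (x - 1) * expR x + 1.
Proof.
move=> x0.
have : 1 - x < expR (- x) by apply: expR_gt1Dx; rewrite oppr_eq0 gt_eqF.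
by rewrite -(ltr_pM2l (expR_gt0 x)) expRxMexpNx_1; lra.
Qed.

Lemma expR_sub2_gt0 x : 0 < x -> 0 < (x - 2) * expR x + x + 2.
Proof.
move: x; apply: (@gt0_derive_gt0 _ (fun x => (x - 1) * expR x + 1)).
- by move=> x; apply: is_derive_eq; rewrite /GRing.scale/=; ring.
- by rewrite expR0; ring.
- exact: expR_sub1_gt0.
Qed.

Lemma expR_quadratic_gt0 x : 0 < x -> 0 < 2 * expR x - (x ^+ 2 + 2 * x + 2).
Proof.
move: x; apply: (@gt0_derive_gt0 _ (fun x => 2 * expR x - (2 * x + 2))).
- by move=> x; apply: is_derive_eq; rewrite /GRing.scale/=; ring.
- by rewrite expR0; ring.
- move=> x x0; have : 1 + x < expR x by apply: expR_gt1Dx; rewrite gt_eqF.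
  lra.
Qed.

(** Multiplying numerator and denominator of q by e^k. *)
Lemma qE k : 0 < k ->
  0 < k * (expR k - 1 - k) /\
  q k = ((k - 2) * expR k + k + 2) / (k * (expR k - 1 - k)).
Proof.
move=> k0; have kn0 : k != 0 by rewrite gt_eqF.
have d0 : 0 < expR k - 1 - k.
  by have : 1 + k < expR k by [apply: expR_gt1Dx]; lra.
split; first by rewrite mulr_gt0.
rewrite /q (negbTE kn0) expRN; field.
by rewrite kn0 !gt_eqF ?expR_gt0.
Qed.

Lemma q_itv k : 0 <= k -> 0 < q k < 1.
Proof.
rewrite le_eqVlt => /predU1P[<-|k0]; first by rewrite /q eqxx; lra.
have [d0 ->] := qE k0; rewrite divr_gt0 ?expR_sub2_gt0//= ltr_pdivrMr// mul1r.
by have := expR_quadratic_gt0 k0; lra.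
Qed.

(** The weight (1 - y) e^(k y) on [0, 1] has mean q k: A is an antiderivative of
this weight times y - q k. *)
Lemma q_mean k : 0 <= k -> exists A : R -> R,
  (forall y, is_derive y 1 A ((y - q k) * ((1 - y) * expR (k * y)))) /\ A 1 = A 0.
Proof.
rewrite le_eqVlt => /predU1P[<-|k0].
  exists (fun y => - y ^+ 3 / 3 + y ^+ 2 * (2 / 3) - y / 3); split; last by field.
  move=> y; apply: is_derive_eq; rewrite /q eqxx mul0r expR0 /GRing.scale/=.
  by field.
have [d0 qk] := qE k0.
(* Coefficients of the polynomial factor of A, found by matching powers of y. *)
pose a2 := - k^-1; pose a1 := (1 + q k + 2 / k) / k; pose a0 := (- q k - a1) / k.
have kn0 : k != 0 by rewrite gt_eqF.
exists (fun y => (a2 * y ^+ 2 + a1 * y + a0) * expR (k * y)); split.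
  move=> y; apply: is_derive_eq; rewrite /GRing.scale/= /a0 /a1 /a2; field.
  exact: kn0.
have {}d0 : expR k - 1 - k != 0.
  by move/lt0r_neq0: d0; rewrite mulf_eq0 negb_or => /andP[].
by rewrite (mulr1 k) (mulr0 k) expR0 /a0 /a1 /a2 qk; field; rewrite kn0.
Qed.

End Q.

(** * Means under a tilted ramp *)

Section TiltedRamp.
Context {R : realType}.
Local Notation mu := (@lebesgue_measure R).
Implicit Types (f g v : R -> R) (a b c s t u x y k : R).

Lemma integrable_continuous_itv f a b : continuous f ->
  mu.-integrable `[a, b] (EFin \o f).
Proof.
move=> cf; apply: continuous_compact_integrable; first exact: segment_compact.
exact: continuous_subspaceT.
Qed.

Lemma continuous_FTC2_global f F a b : a < b -> continuous f ->
  (forall x, is_derive x 1 F (f x)) -> \int[mu]_(x in `[a, b]) f x = F b - F a.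
Proof.
move=> ab cf dF.
have cF : continuous F.
  by move=> x; apply: differentiable_continuous; apply/derivable1_diffP; exact: ex_derive.
rewrite /Rintegral (@continuous_FTC2 _ f F) => //.
- exact: continuous_subspaceT.
- split=> [x _||]; first exact: ex_derive.
  + by apply: cvg_at_right_filter; exact: cF.
  + by apply: cvg_at_left_filter; exact: cF.
- by move=> x _; rewrite derive1E derive_val.
Qed.

Definition ramp_weight k y : R := (1 - y) * expR (k * y).

Lemma continuous_ramp_weight k c u (m : R) :
  continuous (fun x => ((x - c) / (u - c) - m) * ramp_weight k ((x - c) / (u - c))).
Proof.
move=> x; apply: differentiable_continuous; apply/derivable1_diffP.
exact: ex_derive.
Qed.

(** Here and below y = (x - c) / (u - c) runs from 0 at c to 1 at u, where c may
be either end of the interval: both orientations are needed. *)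
Lemma ramp_mean_zero k c u a b : 0 <= k -> a < b ->
  (c = a /\ u = b) \/ (c = b /\ u = a) ->
  \int[mu]_(x in `[a, b])
    (((x - c) / (u - c) - q k) * ramp_weight k ((x - c) / (u - c))) = 0.
Proof.
move=> k0 ab cu; have [A [dA A01]] := q_mean k0.
have uc : u - c != 0.
  by rewrite subr_eq0; case: cu => -[-> ->]; rewrite ?(gt_eqF ab) ?(lt_eqF ab).
pose F x := (u - c) * A ((x - c) / (u - c)).
have dF x : is_derive x 1 F
    (((x - c) / (u - c) - q k) * ramp_weight k ((x - c) / (u - c))).
  have dy : is_derive x 1 (fun x => (x - c) / (u - c)) (u - c)^-1.
    by apply: is_derive_eq; rewrite /GRing.scale/=; ring.
  have dAy := dA ((x - c) / (u - c)).
  have dc := @is_derive1_comp _ A (fun x => (x - c) / (u - c)) x _ _ dAy dy.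
  have dF := is_deriveZ (u - c) dc.
  apply: (is_derive_eq dF).
  by rewrite /GRing.scale/= /ramp_weight; field.
rewrite (continuous_FTC2_global ab (@continuous_ramp_weight k c u (q k)) dF) /F.
by case: cu uc => -[-> ->] uc; rewrite divff// subrr mul0r A01 subrr.
Qed.

(** If v / w is nonincreasing in y, where w is a weight with mean q k, then the
mean of y under v is at most q k: compare v with its multiple of w that agrees
with it at y = q k. *)
Lemma ramp_mean_le v k c u a b : 0 <= k -> a < b ->
  (c = a /\ u = b) \/ (c = b /\ u = a) ->
  mu.-integrable `[a, b] (EFin \o v) ->
  (forall x x', a <= x <= b -> a <= x' <= b ->
    (x - c) / (u - c) < (x' - c) / (u - c) ->
    v x' * ramp_weight k ((x - c) / (u - c)) <=
    v x * ramp_weight k ((x' - c) / (u - c))) ->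
  \int[mu]_(x in `[a, b]) (v x * ((x - c) / (u - c) - q k)) <= 0.
Proof.
move=> k0 ab cu intv mono.
have /andP[q0 q1] := q_itv k0.
have uc : u - c != 0.
  by rewrite subr_eq0; case: cu => -[-> ->]; rewrite ?(gt_eqF ab) ?(lt_eqF ab).
pose xq := c + q k * (u - c).
have yq : (xq - c) / (u - c) = q k by rewrite /xq; field.
have xqab : a <= xq <= b.
  by rewrite /xq; case: cu => -[-> ->]; apply/andP; split; nra.
have wq : 0 < ramp_weight k (q k) by rewrite mulr_gt0 ?expR_gt0// subr_gt0.
pose C := v xq / ramp_weight k (q k).
have cw := @continuous_ramp_weight k c u (q k).
have intw := integrable_continuous_itv a b cw.
rewrite -[leRHS](mulr0 C) -(ramp_mean_zero k0 ab cu).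
have mI : measurable (`[a, b]%classic : set (measurableTypeR R)) by exact: measurable_itv.
rewrite -RintegralZl//; apply: le_Rintegral => //.
- apply: (integrable_mul_bounded (B := 1)) => //.
    by apply: measurable_funB => //; apply: measurable_funM => //; exact: measurable_funB.
  move=> x; rewrite /= in_itv/= => /andP[ax xb] _.
  have : 0 <= (x - c) / (u - c) <= 1.
    case: cu => -[-> ->].
      by rewrite divr_ge0 ?ler_pdivrMr ?mul1r ?subr_gt0 ?subr_ge0 ?lerB// ltW.
    rewrite -mulrNN -invrN !opprB.
    by rewrite divr_ge0 ?ler_pdivrMr ?mul1r ?subr_gt0 ?subr_ge0 ?lerB// ltW.
  by move=> /andP[y0 y1]; rewrite ler_norml; apply/andP; split; lra.
- exact: integrable_scale.
move=> x; rewrite /= in_itv/= => xab.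
set y := (x - c) / (u - c).
rewrite -subr_ge0 (_ : _ - _ = (y - q k) * (C * ramp_weight k y - v x)); last ring.
have CE z : C * ramp_weight k z = v xq * ramp_weight k z / ramp_weight k (q k).
  by rewrite /C; ring.
have [yq'|qy|e] := ltgtP y (q k); last by rewrite e subrr mul0r.
- rewrite nmulr_rge0 ?subr_lt0// subr_le0 CE ler_pdivrMr//.
  by have := mono x xq xab xqab; rewrite yq; apply.
- rewrite pmulr_rge0 ?subr_gt0// subr_ge0 CE ler_pdivlMr//.
  by have := mono xq x xqab xab; rewrite yq; apply.
Qed.

End TiltedRamp.

(** * Interior extrema of a difference of distribution functions *)

Section OneSided.
Context {R : realType}.
Local Notation mu := (@lebesgue_measure R).
Implicit Types (f g v : R -> R) (a b c s t u x y k : R).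

Lemma Rintegral_ge0_ex v a b : a < b -> mu.-integrable `[a, b] (EFin \o v) ->
  0 <= \int[mu]_(x in `[a, b]) v x -> exists x, a < x < b /\ 0 <= v x.
Proof.
move=> ab intv int0; apply/not_existsP => vneg.
have intv' : mu.-integrable `]a, b[ (EFin \o v).
  by apply: integrableS intv => //; exact: subset_itv_oo_cc.
have intNv : mu.-integrable setT (EFin \o ((fun x => -1 * v x) \_ `]a, b[)).
  rewrite -restrict_EFin; apply/integrable_restrict => //; rewrite ?setTI//.
  exact: integrable_scale.
have : 0 < \int[mu]_x ((fun x => -1 * v x) \_ `]a, b[) x.
  have p0 : point = 0 :> R by [].
  have pos x : a < x < b -> 0 < -1 * v x.
    move=> xab; rewrite mulN1r oppr_gt0 ltNge; apply/negP => v0.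
    by apply: (vneg x).
  apply: (Rintegral_gt0_itv intNv _ ab) => x; rewrite patchE mem_setE in_itv/=.
    by case: ifP => [/pos/ltW|]//; rewrite p0.
  by move=> xab; rewrite xab; exact: pos.
rewrite -Rintegral_mkcond RintegralZl//.
rewrite mulN1r oppr_gt0 ltNge Rintegral_itv_bndo_bndc//.
rewrite Rintegral_itv_obnd_cbnd ?int0//.
by apply: integrableS intv => //; exact: subset_itv_oc_cc.
Qed.

Lemma Rintegral_le0_ex v a b : a < b -> mu.-integrable `[a, b] (EFin \o v) ->
  \int[mu]_(x in `[a, b]) v x <= 0 -> exists x, a < x < b /\ v x <= 0.
Proof.
move=> ab intv int0.
have mI : measurable (`[a, b]%classic : set (measurableTypeR R)) by exact: measurable_itv.
have [||x [xab vx]] := @Rintegral_ge0_ex (fun x => -1 * v x) a b ab.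
- exact: integrable_scale.
- by rewrite RintegralZl// mulN1r oppr_ge0.
- by exists x; split=> //; move: vx; rewrite mulN1r oppr_ge0.
Qed.

Definition convex3 s t g : Prop := forall x y z, s <= x -> x < y -> y < z -> z <= t ->
  (z - x) * g y <= (z - y) * g x + (y - x) * g z.

(** A convex function that changes sign at u from nonnegative to nonpositive
behaves on the left of u as if it vanished at u: it is nonnegative there, and
g x / (u - x) is nonincreasing. Sign changes are expressed by nearby points, as
they come from integrals of g. *)
Lemma convex3_downcross s t u g : convex3 s t g -> s < u < t ->
  (forall a, s <= a < u -> exists x, a < x < u /\ 0 <= g x) ->
  (forall b, u < b <= t -> exists x, u < x < b /\ g x <= 0) ->
  (forall x, s <= x < u -> 0 <= g x) /\
  (forall x x', s <= x -> x < x' -> x' <= u ->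
    g x' * (u - x) <= g x * (u - x')).
Proof.
move=> cg /andP[su ut] gl gr; split.
- move=> x /andP[sx xu]; rewrite leNgt; apply/negP => gx.
  have [|y [/andP[xy yu] gy]] := gl x; first by rewrite sx.
  have [|z [/andP[uz zt] gz]] := gr t; first by rewrite ut lexx.
  have := cg x y z sx xy (lt_trans yu uz) (ltW zt).
  have h1 : 0 <= (z - x) * g y by rewrite mulr_ge0// subr_ge0; lra.
  have h2 : (z - y) * g x < 0 by rewrite pmulr_rlt0// subr_gt0; lra.
  have h3 : (y - x) * g z <= 0 by rewrite pmulr_rle0// subr_gt0.
  by lra.
- move=> x x' sx xx' x'u; rewrite -subr_le0; apply/ler_addgt0Pr => e e0.
  have d0 : 0 < `|g x - g x'| + 1 by rewrite ltr_wpDl.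
  have [|z [/andP[uz zb] gz]] := gr (Num.min t (u + e / (`|g x - g x'| + 1))).
    by rewrite lt_min ut ltrDl divr_gt0//= ge_min lexx.
  move: zb; rewrite lt_min => /andP[zt]; rewrite -ltrBlDl ltr_pdivlMr// => ze.
  have := cg x x' z sx xx' (le_lt_trans x'u uz) (ltW zt).
  have h3 : (x' - x) * g z <= 0 by rewrite pmulr_rle0// subr_gt0.
  have zu : 0 < z - u by rewrite subr_gt0.
  have := ler_wpM2l (ltW zu) (ler_norm (g x - g x')).
  by lra.
Qed.

(** The reflection x -> - x exchanges this with convex3_downcross. *)
Lemma convex3_upcross s t u g : convex3 s t g -> s < u < t ->
  (forall a, s <= a < u -> exists x, a < x < u /\ g x <= 0) ->
  (forall b, u < b <= t -> exists x, u < x < b /\ 0 <= g x) ->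
  (forall x, u < x <= t -> 0 <= g x) /\
  (forall x x', x <= t -> x' < x -> u <= x' ->
    g x' * (x - u) <= g x * (x' - u)).
Proof.
move=> cg /andP[su ut] gl gr.
have [|||| pos mono] := @convex3_downcross (- t) (- s) (- u) (fun x => g (- x)).
- move=> x y z sx xy yz zt.
  have zs : s <= - z by lra.
  have yz' : - z < - y by lra.
  have xy' : - y < - x by lra.
  have xt : - x <= t by lra.
  by have := cg (- z) (- y) (- x) zs yz' xy' xt; lra.
- by rewrite !ltrN2 ut.
- move=> a; rewrite lerNl ltrNr => /andP[ta au].
  have [|x [/andP[ux xa] gx]] := gr (- a); first by rewrite au.
  by exists (- x); rewrite ltrNr xa ltrN2 ux opprK.
- move=> b; rewrite ltrNl lerNr => /andP[ub bs].
  have [|x [/andP[bx xu] gx]] := gl (- b); first by rewrite bs.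
  by exists (- x); rewrite ltrN2 xu ltrNl bx opprK.
split.
- by move=> x /andP[ux xt]; have := pos (- x); rewrite lerN2 xt ltrN2 ux opprK; apply.
- move=> x x' xt x'x ux'; have := mono (- x) (- x').
  by rewrite !lerN2 ltrN2 !opprK ![- u + _]addrC; apply.
Qed.

Lemma concave_on3 a b h : concave_on `[a, b] h ->
  convex3 a b (fun x => - h x).
Proof.
move=> ch x y z ax xy yz zb.
have xz : x < z by exact: lt_trans yz.
have zx0 : z - x != 0 by rewrite subr_eq0 gt_eqF.
have t01 : (0 <= (z - y) / (z - x) <= 1)%R.
  by rewrite divr_ge0 ?ler_pdivrMr ?mul1r ?subr_gt0//; lra.
have := ch (Itv01 (andP t01).1 (andP t01).2) x z.
rewrite !inE /= !in_itv/= ax (ltW (lt_le_trans xz zb)) => /(_ erefl).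
rewrite zb (ltW (le_lt_trans ax xz)) => /(_ erefl).
rewrite !convRE /=.
set c := (X in - h X <= _).
have -> : c = y.
  transitivity ((z - y) / (z - x) * x + (1 - (z - y) / (z - x)) * z).
    exact: convRE.
  by field.
have zx : 0 <= z - x by rewrite subr_ge0 ltW.
move=> /(ler_wpM2l zx).
rewrite [X in _ <= X -> _](_ : _ = (z - y) * - h x + (y - x) * - h z)//.
by rewrite /unstable.onem; field.
Qed.

Lemma convex3_expR p r a b : convex3 a b (fun x => expR (p * x + r)).
Proof.
move=> x y z ax xy yz zb.
have tangent w : expR (p * y + r) * (1 + p * (w - y)) <= expR (p * w + r).
  have -> : p * w + r = (p * y + r) + p * (w - y) by ring.
  by rewrite (expRD (p * y + r)) ler_wpM2l ?expR_ge0// expR_ge1Dx.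
have zy0 : 0 <= z - y by rewrite subr_ge0 ltW.
have yx0 : 0 <= y - x by rewrite subr_ge0 ltW.
have := ler_wpM2l zy0 (tangent x); have := ler_wpM2l yx0 (tangent z); lra.
Qed.

(** Tilting by e^(alpha x) multiplies a ratio that decreases with y by an
exponential which grows no faster than e^(k y). *)
Lemma tilted_ramp_mean_le v g alpha k c u a b : 0 <= k -> a < b ->
  (c = a /\ u = b) \/ (c = b /\ u = a) -> alpha * (u - c) <= k ->
  mu.-integrable `[a, b] (EFin \o v) ->
  (forall x, a <= x <= b -> v x = expR (alpha * x) * g x) ->
  (forall x, a <= x <= b -> (x - c) / (u - c) < 1 -> 0 <= g x) ->
  (forall x x', a <= x <= b -> a <= x' <= b ->
    (x - c) / (u - c) < (x' - c) / (u - c) ->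
    g x' * (1 - (x - c) / (u - c)) <= g x * (1 - (x' - c) / (u - c))) ->
  \int[mu]_(x in `[a, b]) (v x * ((x - c) / (u - c) - q k)) <= 0.
Proof.
move=> k0 ab cu ak intv vE g0 gmono.
have uc : u - c != 0.
  by rewrite subr_eq0; case: cu => -[-> ->]; rewrite ?(gt_eqF ab) ?(lt_eqF ab).
apply: ramp_mean_le => // x x' xab x'ab yy'.
rewrite !vE// /ramp_weight.
set y := (x - c) / (u - c) in yy' *; set y' := (x' - c) / (u - c) in yy' *.
have y'1 : y' <= 1.
  move/andP: x'ab => [ax' x'b]; rewrite /y'; case: cu => -[-> ->].
    by rewrite ler_pdivrMr ?subr_gt0// mul1r lerB.
  by rewrite -mulrNN -invrN !opprB ler_pdivrMr ?subr_gt0// mul1r lerB.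
have := gmono x x' xab x'ab yy'; rewrite -/y -/y' => gyy'.
have gx : 0 <= g x by apply: g0 => //; exact: lt_le_trans y'1.
have e1 : expR (alpha * x') * g x' * ((1 - y) * expR (k * y)) =
  expR (alpha * x' + k * y) * (g x' * (1 - y)) by rewrite expRD; ring.
have e2 : expR (alpha * x) * g x * ((1 - y') * expR (k * y')) =
  expR (alpha * x + k * y') * (g x * (1 - y')) by rewrite expRD; ring.
rewrite e1 e2; apply: (@le_trans _ _ (expR (alpha * x' + k * y) * (g x * (1 - y')))).
  by rewrite ler_wpM2l ?expR_ge0.
rewrite ler_wpM2r ?mulr_ge0 ?subr_ge0// ler_expR.
have -> : x' = x + (u - c) * (y' - y) by rewrite /y /y'; field.
have yy0 : 0 <= y' - y by rewrite subr_ge0 ltW.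
by have := ler_wpM2r yy0 ak; lra.
Qed.

Context (f1 f0 g : R -> R) (s t alpha k : R).
Hypotheses (d1 : is_density f1) (d0 : is_density f0) (k0 : 0 <= k)
  (k_alpha : `|alpha| * (t - s) <= k) (cg : convex3 s t g)
  (f10 : forall x, s <= x <= t -> f1 x - f0 x = expR (alpha * x) * g x).

Let D x := distribution_function f1 x - distribution_function f0 x.

Let v x := f1 x - f0 x.

Let int_v a b : mu.-integrable `[a, b] (EFin \o v).
Proof. by apply: integrable_sub => //; exact: density_itv. Qed.

Let D_sub a b : a <= b -> D b - D a = \int[mu]_(x in `[a, b]) v x.
Proof.
move=> ab; rewrite RintegralB//; [|exact: density_itv|exact: density_itv].
by rewrite -!df_sub// /D; ring.
Qed.

Let ramp_D a b : a <= b ->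
  \int[mu]_x (f1 x * (hinge b x - hinge a x)) -
  \int[mu]_x (f0 x * (hinge b x - hinge a x)) =
  (b - a) * D a + \int[mu]_(x in `[a, b]) (v x * (b - x)).
Proof.
move=> ab; rewrite !density_ramp_integral//.
have intr f : is_density f ->
    mu.-integrable `[a, b] (EFin \o fun x => f x * (b - x)).
  move=> df; apply: (integrable_mul_bounded (B := b - a)) => //.
  - exact: density_itv.
  - exact: measurable_funB.
  - move=> x; rewrite /= in_itv/= => /andP[ax xb] _.
    by rewrite ger0_norm ?subr_ge0// lerB.
have -> : \int[mu]_(x in `[a, b]) (v x * (b - x)) =
   \int[mu]_(x in `[a, b]) (f1 x * (b - x)) - \int[mu]_(x in `[a, b]) (f0 x * (b - x)).
  rewrite -RintegralB//; [|exact: intr|exact: intr].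
  by apply: eq_Rintegral => x _; rewrite /v; ring.
by rewrite /D; ring.
Qed.

Let v_ge0 x : s <= x <= t -> (0 <= v x) = (0 <= g x).
Proof. by move=> xst; rewrite /v f10// pmulr_rge0 ?expR_gt0. Qed.

Let v_le0 x : s <= x <= t -> (v x <= 0) = (g x <= 0).
Proof. by move=> xst; rewrite /v f10// pmulr_rle0 ?expR_gt0. Qed.

Let alpha_le c u : `|u - c| <= t - s -> alpha * (u - c) <= k.
Proof.
move=> uc; apply: le_trans k_alpha; apply: le_trans (ler_norm _) _.
by rewrite normrM ler_wpM2l.
Qed.

Let int_v_scale a b (m l : R) :
  \int[mu]_(x in `[a, b]) (v x * (m * (b - x) + l)) =
  m * \int[mu]_(x in `[a, b]) (v x * (b - x)) + l * \int[mu]_(x in `[a, b]) v x.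
Proof.
have mI : measurable (`[a, b]%classic : set (measurableTypeR R)) by exact: measurable_itv.
have intr : mu.-integrable `[a, b] (EFin \o fun x => v x * (b - x)).
  apply: (integrable_mul_bounded (B := b - a)) => //; first exact: measurable_funB.
  move=> x; rewrite /= in_itv/= => /andP[ax xb] _.
  by rewrite ger0_norm ?subr_ge0// lerB.
rewrite -RintegralZl// -RintegralZl// -RintegralD//; first last.
- exact: integrable_scale.
- exact: integrable_scale.
by apply: eq_Rintegral => x _; ring.
Qed.

(** Left of an interior maximum u, the derivative of D is e^(alpha x) g x with g
convex, nonnegative and crossing 0 at u. Its mean position on [s, u], on the
scale of y, is thus at most q k, and integration by parts turns that mean
position into the integral of D over [s, u]. *)
Lemma df_sub_max u : s < u < t -> (forall x, s <= x <= t -> D x <= D u) ->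
  (1 - q k) * (u - s) * D u <=
  \int[mu]_x (f1 x * (hinge u x - hinge s x)) -
  \int[mu]_x (f0 x * (hinge u x - hinge s x)) - q k * (u - s) * D s.
Proof.
move=> /andP[su ut] Du.
have [|||g0 gmono] := convex3_downcross (u := u) cg; first by rewrite su.
- move=> a /andP[sa au]; have [||x [/andP[ax xu] vx]] := @Rintegral_ge0_ex v a u au.
  + exact: int_v.
  + by rewrite -(D_sub (ltW au)) subr_ge0 Du// sa (ltW (lt_trans au ut)).
  by exists x; rewrite ax xu -v_ge0//; apply/andP; split; lra.
- move=> b /andP[ub bt]; have [||x [/andP[ux xb] vx]] := @Rintegral_le0_ex v u b ub.
  + exact: int_v.
  + by rewrite -(D_sub (ltW ub)) subr_le0 Du// bt andbT; lra.
  by exists x; rewrite ux xb -v_le0//; apply/andP; split; lra.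
have us0 : 0 < u - s by rewrite subr_gt0.
have usn0 : u - s != 0 by rewrite gt_eqF.
have := @tilted_ramp_mean_le v g alpha k s u s u k0 su (or_introl (conj erefl erefl)).
have -> : \int[mu]_(x in `[s, u]) (v x * ((x - s) / (u - s) - q k)) =
    \int[mu]_(x in `[s, u]) (v x * (- (u - s)^-1 * (u - x) + (1 - q k))).
  by apply: eq_Rintegral => x _; congr (_ * _); field.
rewrite int_v_scale -(D_sub (ltW su)) => H.
rewrite (ramp_D (ltW su)).
have : - (u - s)^-1 * \int[mu]_(x in `[s, u]) (v x * (u - x)) + (1 - q k) * (D u - D s) <= 0.
  apply: H => //.
  - by apply: alpha_le; rewrite gtr0_norm// lerD2r ltW.
  - by move=> x /andP[sx xu]; rewrite /v f10// sx (le_trans xu)// ltW.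
  - by move=> x /andP[sx _]; rewrite ltr_pdivrMr// mul1r ltrD2r => xu; rewrite g0// sx.
  - move=> x x' /andP[sx xu] /andP[sx' x'u]; rewrite ltr_pM2r ?invr_gt0// ltrD2r => xx'.
    have e z : 1 - (z - s) / (u - s) = (u - z) / (u - s) by field.
    by rewrite !e !mulrA ler_pM2r ?invr_gt0//; exact: gmono.
set J := \int[mu]_(x in _) _ => le.
have := ler_wpM2l (ltW us0) le.
rewrite mulr0 mulrDr mulrA mulrN mulfV// mulN1r; lra.
Qed.

(** The same with the anchor at t instead of s. *)
Lemma df_sub_min u : s < u < t -> (forall x, s <= x <= t -> D u <= D x) ->
  \int[mu]_x (f1 x * (hinge t x - hinge u x)) -
  \int[mu]_x (f0 x * (hinge t x - hinge u x)) - q k * (t - u) * D t <=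
  (1 - q k) * (t - u) * D u.
Proof.
move=> /andP[su ut] Du.
have [|||g0 gmono] := convex3_upcross (u := u) cg; first by rewrite su.
- move=> a /andP[sa au]; have [||x [/andP[ax xu] vx]] := @Rintegral_le0_ex v a u au.
  + exact: int_v.
  + by rewrite -(D_sub (ltW au)) subr_le0 Du// sa (ltW (lt_trans au ut)).
  by exists x; rewrite ax xu -v_le0//; apply/andP; split; lra.
- move=> b /andP[ub bt]; have [||x [/andP[ux xb] vx]] := @Rintegral_ge0_ex v u b ub.
  + exact: int_v.
  + by rewrite -(D_sub (ltW ub)) subr_ge0 Du// bt andbT; lra.
  by exists x; rewrite ux xb -v_ge0//; apply/andP; split; lra.
have us0 : 0 < t - u by rewrite subr_gt0.
have usn0 : t - u != 0 by rewrite gt_eqF.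
have yE z : (z - t) / (u - t) = (t - z) / (t - u).
  by rewrite -mulrNN -invrN !opprB.
have := @tilted_ramp_mean_le v g alpha k t u u t k0 ut (or_intror (conj erefl erefl)).
have -> : \int[mu]_(x in `[u, t]) (v x * ((x - t) / (u - t) - q k)) =
    \int[mu]_(x in `[u, t]) (v x * ((t - u)^-1 * (t - x) + - q k)).
  by apply: eq_Rintegral => x _; rewrite yE; congr (_ * _); field.
rewrite int_v_scale -(D_sub (ltW ut)) => H.
rewrite (ramp_D (ltW ut)).
have : (t - u)^-1 * \int[mu]_(x in `[u, t]) (v x * (t - x)) + - q k * (D t - D u) <= 0.
  apply: H => //.
  - by apply: alpha_le; rewrite distrC gtr0_norm// lerB// ltW.
  - by move=> x /andP[ux xt]; rewrite /v f10// xt andbT (le_trans (ltW su)).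
  - move=> x /andP[ux xt]; rewrite yE ltr_pdivrMr// mul1r ltrD2l ltrN2 => xu.
    by rewrite g0// xu.
  - move=> x x' /andP[ux xt] /andP[ux' x't]; rewrite !yE ltr_pM2r ?invr_gt0//.
    rewrite ltrD2l ltrN2 => xx'.
    have e z : 1 - (t - z) / (t - u) = (z - u) / (t - u) by field.
    by rewrite !e !mulrA ler_pM2r ?invr_gt0//; exact: gmono.
set J := \int[mu]_(x in _) _ => le.
have := ler_wpM2l (ltW us0) le.
rewrite mulr0 mulrDr mulrA mulfV// mul1r; lra.
Qed.

End OneSided.

(** * Balanced points *)

Section Balanced.
Context {R : realType} (n : nat) (X : 'I_n -> R).
Local Notation mu := (@lebesgue_measure R).
Implicit Types (f g : R -> R) (a b c s t u x y k delta : R).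

Lemma df_right_near f s (e : R) : is_density f -> 0 < e ->
  exists u, s < u /\ distribution_function f u <= distribution_function f s + e.
Proof.
move=> df e0; have s1 : s < s + 1 by rewrite ltrDl.
have := df_continuous df (ltW s1).
move=> /(continuous_within_itvP _ s1)[_ + _].
move=> /cvgr_le/(_ (distribution_function f s + e)).
rewrite ltrDl => /(_ e0) nu; near (s^'+) => u; exists u; split; near: u => //.
exact: nbhs_right_gt.
Unshelve. all: by end_near. Qed.

Lemma df_left_near f t (e : R) : is_density f -> 0 < e ->
  exists u, u < t /\ distribution_function f t - e <= distribution_function f u.
Proof.
move=> df e0; have s1 : t - 1 < t by rewrite ltrBlDr ltrDl.
have := df_continuous df (ltW s1).
move=> /(continuous_within_itvP _ s1)[_ _ +].
move=> /cvgr_ge/(_ (distribution_function f t - e)).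
rewrite ltrBlDr ltrDl => /(_ e0) nu; near (t^'-) => u; exists u; split; near: u => //.
exact: nbhs_left_lt.
Unshelve. all: by end_near. Qed.

Context (f f0 : R -> R) (a b delta : R).
Hypotheses (mle : is_log_concave_mle X f) (n0 : (0 < n)%N)
  (fX : forall i, 0 < f (X i)) (fab : forall x, f x != 0 -> a <= x <= b).
Hypotheses (df0 : is_density f0)
  (bound : forall x, `|empirical_df X x - distribution_function f0 x| <= delta).

Let df : is_density f.
Proof. by case: mle.1. Qed.

Let n0r : 0 < n%:R :> R.
Proof. by rewrite ltr0n. Qed.

Let int_ramp s u : \int[mu]_x (f x * (hinge u x - hinge s x)) =
  \int[mu]_x (f x * hinge u x) - \int[mu]_x (f x * hinge s x).
Proof.
have inth z : mu.-integrable setT (EFin \o fun x => f x * hinge z x).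
  apply: (integrable_mul_bounded (B := `|z| + `|a|)) => //.
  - exact: density_integrable.
  - by apply: continuous_measurable_fun; exact: continuous_hinge.
  - by move=> x _ /fab; exact: hinge_bound.
by rewrite -RintegralB//; apply: eq_Rintegral => x _; ring.
Qed.

Let mean_ramp s u : n%:R^-1 * \sum_(i < n) (hinge u (X i) - hinge s (X i)) =
  n%:R^-1 * \sum_(i < n) hinge u (X i) - n%:R^-1 * \sum_(i < n) hinge s (X i).
Proof. by rewrite sumrB mulrBr. Qed.

Let mean_hinge_ge z : \int[mu]_x (f x * hinge z x) <= n%:R^-1 * \sum_(i < n) hinge z (X i).
Proof. by rewrite mulrC ler_pdivlMr// mulrC; exact: mle_hinge_le fab z. Qed.

Let mean_hinge_eq z : balanced X f z ->
  n%:R^-1 * \sum_(i < n) hinge z (X i) = \int[mu]_x (f x * hinge z x).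
Proof. by move=> ->; rewrite mulKf// gt_eqF. Qed.

Lemma balanced_ramp_le s u : balanced X f s ->
  \int[mu]_x (f x * (hinge u x - hinge s x)) <=
  n%:R^-1 * \sum_(i < n) (hinge u (X i) - hinge s (X i)).
Proof.
by move=> bs; rewrite int_ramp mean_ramp (mean_hinge_eq bs) lerD2r mean_hinge_ge.
Qed.

Lemma balanced_ramp_ge v t : balanced X f t ->
  n%:R^-1 * \sum_(i < n) (hinge t (X i) - hinge v (X i)) <=
  \int[mu]_x (f x * (hinge t x - hinge v x)).
Proof.
by move=> bt; rewrite int_ramp mean_ramp (mean_hinge_eq bt) lerD2l lerN2 mean_hinge_ge.
Qed.

Let mean_indicator (c z : R) :
  n%:R^-1 * \sum_(i < n) (c * (X i <= z)%R%:R) = c * empirical_df X z.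
Proof. by rewrite -mulr_sumr /empirical_df; ring. Qed.

(** Compare ramps over a short interval on one side of z: there the mean of the
ramp under f and under the empirical law are ordered, and each, divided by the
length of the interval, lies between the values of its distribution function at
the two ends. Let the length tend to 0, using that the distribution function of
f0 is continuous. *)
Lemma balanced_df z : balanced X f z ->
  `|distribution_function f z - distribution_function f0 z| <= delta.
Proof.
move=> bz; have f_ge0 x : 0 <= f x by case: df.
have ni0 : 0 <= n%:R^-1 :> R by rewrite invr_ge0 ler0n.
rewrite ler_norml; apply/andP; split.
- apply/ler_addgt0Pr => e e0.
  have [u [uz Fu]] := df_left_near z df0 e0.
  have zu : 0 < z - u by rewrite subr_gt0.
  suff le : empirical_df X u <= distribution_function f z.
    by have := bound u; rewrite ler_norml => /andP[]; lra.
  rewrite -(ler_pM2l zu) -mean_indicator.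
  apply: le_trans (_ : n%:R^-1 * \sum_(i < n) (hinge z (X i) - hinge u (X i)) <= _).
    by rewrite ler_wpM2l// ler_sum// => i _; apply: ramp_ge; exact: ltW.
  apply: le_trans (balanced_ramp_ge u bz) _.
  rewrite density_ramp_integral// ?(ltW uz)//.
  have <- : distribution_function f u + \int[mu]_(x in `[u, z]) f x = distribution_function f z.
    by rewrite -df_sub ?(ltW uz)//; ring.
  rewrite mulrDr lerD2l -RintegralZl//; last exact: density_itv.
  apply: le_Rintegral => //.
  + apply: (integrable_mul_bounded (B := z - u)) => //; first exact: density_itv.
      exact: measurable_funB.
    move=> x; rewrite /= in_itv/= => /andP[ux xz] _.
    by rewrite ger0_norm ?subr_ge0// lerB.
  + by apply: integrable_scale => //; exact: density_itv.
  + move=> x; rewrite /= in_itv/= => /andP[ux xz].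
    by rewrite mulrC ler_wpM2r// lerB.
- apply/ler_addgt0Pr => e e0.
  have [u [zu Fu]] := df_right_near z df0 e0.
  have uz : 0 < u - z by rewrite subr_gt0.
  suff le : distribution_function f z <= empirical_df X u.
    by have := bound u; rewrite ler_norml => /andP[]; lra.
  rewrite -(ler_pM2l uz) -mean_indicator.
  apply: le_trans (_ : n%:R^-1 * \sum_(i < n) (hinge u (X i) - hinge z (X i)) <= _); last first.
    by rewrite ler_wpM2l// ler_sum// => i _; apply: ramp_le; exact: ltW.
  apply: le_trans (balanced_ramp_le u bz).
  rewrite density_ramp_integral// ?(ltW zu)// lerDl Rintegral_ge0// => x.
  by rewrite /= in_itv/= => /andP[zx xu]; rewrite mulr_ge0// subr_ge0.
Qed.

End Balanced.

(** * The uniform bound *)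

Section SampleRange.
Context {R : realType} (n : nat) (X : 'I_n -> R).

Lemma head_codom_attained : (0 < n)%N -> exists i, X i = head 0 (codom X).
Proof.
move=> n0; have : head 0 (codom X) \in codom X.
  have : (0 < size (codom X))%N by rewrite size_codom card_ord.
  by case: (codom X) => //= y l _; rewrite mem_head.
by move=> /codomP[i ->]; exists i.
Qed.

Lemma sample_min_attained : (0 < n)%N -> exists i, X i = sample_min X.
Proof.
move=> n0; rewrite /sample_min; elim/big_ind: _.
- exact: head_codom_attained.
- by move=> x y [i <-] [j <-]; case: (leP (X i) (X j)) => _; [exists i|exists j].
- by move=> i _; exists i.
Qed.

Lemma sample_max_attained : (0 < n)%N -> exists i, X i = sample_max X.
Proof.
move=> n0; rewrite /sample_max; elim/big_ind: _.
- exact: head_codom_attained.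
- by move=> x y [i <-] [j <-]; case: (leP (X i) (X j)) => _; [exists j|exists i].
- by move=> i _; exists i.
Qed.

Lemma sample_range i : sample_min X <= X i <= sample_max X.
Proof. by rewrite /sample_min /sample_max bigmin_le le_bigmax. Qed.

Lemma empirical_df_itv x : (0 < n)%N -> 0 <= empirical_df X x <= 1.
Proof.
move=> n0; rewrite /empirical_df mulr_ge0 ?invr_ge0 ?ler0n ?sumr_ge0//=.
rewrite mulrC ler_pdivrMr ?ltr0n// mul1r.
rewrite -[n in leRHS]card_ord -sumr_const; apply: ler_sum => i _.
by rewrite lern1 leq_b1.
Qed.

Lemma empirical_df_below x : x < sample_min X -> empirical_df X x = 0.
Proof.
move=> xa; rewrite /empirical_df big1 ?mulr0// => i _.
by rewrite leNgt (lt_le_trans xa)//; have /andP[] := sample_range i.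
Qed.

Lemma empirical_df_above x : (0 < n)%N -> sample_max X < x -> empirical_df X x = 1.
Proof.
move=> n0 bx; rewrite /empirical_df (eq_bigr (fun=> 1)) => [|i _].
  by rewrite sumr_const card_ord mulVf// pnatr_eq0 -lt0n.
by rewrite (le_trans _ (ltW bx))//; have /andP[] := sample_range i.
Qed.

End SampleRange.

Section UniformBound.
Context {R : realType} (n : nat) (X : 'I_n -> R).
Local Notation mu := (@lebesgue_measure R).
Context (f f0 h0 : R -> R) (a b alpha delta : R).
Hypotheses (mle : is_log_concave_mle X f) (n0 : (0 < n)%N)
  (fX : forall i, 0 < f (X i)) (fab : forall x, f x != 0 -> a <= x <= b)
  (ab : a < b) (Xa : exists i, X i = a) (Xb : exists i, X i = b)
  (df0 : is_density f0) (ch0 : concave_on `[a, b] h0)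
  (f0E : forall x, a <= x <= b -> f0 x = expR (alpha * x) * h0 x)
  (bound : forall x, `|empirical_df X x - distribution_function f0 x| <= delta).

Let D x := distribution_function f x - distribution_function f0 x.

Let k : R := `|alpha * (b - a)|.

Let df : is_density f.
Proof. by case: mle.1. Qed.

Let delta_ge0 : 0 <= delta.
Proof. exact: le_trans (bound 0). Qed.

Lemma le_rho_mul : delta <= rho k * delta.
Proof.
have /andP[q0 q1] := q_itv (normr_ge0 (alpha * (b - a))).
rewrite ler_peMl ?delta_ge0// /rho ler_pdivlMr ?subr_gt0//.
by rewrite /k; lra.
Qed.

(** On the affine cell [s, t] around x, the difference D of the distribution
functions is at most delta in absolute value at the ends. At an interior
maximum u the integral of D over [s, u] is at most delta (u - s), since s is
balanced, so df_sub_max gives (1 - q) D u <= delta + q delta. At an interior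
minimum the same holds with t for s. *)
Lemma df_sub_bound_in x : a <= x <= b -> `|D x| <= rho k * delta.
Proof.
move=> xab.
have [s [t [p [r [[sa tb] st xst [bs bt] aff]]]]] :=
  mle_affine_cell mle n0 fX fab ab Xa Xb xab.
have /andP[q0 q1] := q_itv (normr_ge0 (alpha * (b - a))).
rewrite -/k in q0 q1.
have k0 : 0 <= k by exact: normr_ge0.
have Ds := balanced_df mle n0 fX fab df0 bound bs.
have Dt := balanced_df mle n0 fX fab df0 bound bt.
rewrite -/(D s) in Ds; rewrite -/(D t) in Dt.
have dE := delta_ge0; have rE := le_rho_mul.
pose g x := expR ((p - alpha) * x + r) - h0 x.
have cg : convex3 s t g.
  move=> y z w sy yz zw wt.
  have := @convex3_expR _ (p - alpha) r s t y z w sy yz zw wt.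
  have := concave_on3 ch0 (le_trans sa sy) yz zw (le_trans wt tb).
  by rewrite /g; lra.
have fg y : s <= y <= t -> f y - f0 y = expR (alpha * y) * g y.
  move=> yst; rewrite aff// f0E; last first.
    by move/andP: yst => [sy yt]; rewrite (le_trans sa)// (le_trans yt).
  by rewrite /g mulrBr -expRD; congr (expR _ - _); ring.
have ka : `|alpha| * (t - s) <= k.
  rewrite /k normrM ler_wpM2l// (le_trans _ (ler_norm _))//.
  by rewrite lerB.
have cD : {within `[s, t], continuous D}.
  move=> y; apply: cvgB; exact: (df_continuous _ (ltW st)).
move: Ds Dt; rewrite !ler_norml => /andP[Ds1 Ds2] /andP[Dt1 Dt2].
have q1' : 0 < 1 - q k by rewrite subr_gt0.
have rhoE : rho k * delta = (delta + q k * delta) / (1 - q k).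
  by rewrite /rho; ring.
have Dt2' : q k * D t <= q k * delta by rewrite ler_pM2l.
have Ds1' : q k * - delta <= q k * D s by rewrite ler_pM2l.
apply/andP; split.
- have [u] := EVT_min (ltW st) cD; rewrite in_itv/= => /andP[su ut] umin.
  apply: le_trans (umin x _); last by rewrite in_itv.
  move: su; rewrite le_eqVlt => /predU1P[<-|su]; first lra.
  move: ut; rewrite le_eqVlt => /predU1P[->|ut]; first lra.
  have sut : s < u < t by rewrite su.
  have tu0 : 0 < t - u by rewrite subr_gt0.
  have umin' y : s <= y <= t -> D u <= D y by move=> yst; apply: umin; rewrite in_itv.
  have := df_sub_min df df0 k0 ka cg fg sut umin'.
  rewrite -/(D t) -/(D u).
  have := balanced_ramp_ge mle n0 fX fab u bt.
  have := empirical_df_bound (X := X) df0 (ltW ut) bound.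
  rewrite ler_norml => /andP[lb _] ge le.
  rewrite rhoE -mulNr ler_pdivrMr// -(ler_pM2r tu0).
  by have := ler_wpM2r (ltW tu0) Dt2'; lra.
- have [u] := EVT_max (ltW st) cD; rewrite in_itv/= => /andP[su ut] umax.
  apply: le_trans (umax x _) _; first by rewrite in_itv.
  move: su; rewrite le_eqVlt => /predU1P[<-|su]; first lra.
  move: ut; rewrite le_eqVlt => /predU1P[->|ut]; first lra.
  have sut : s < u < t by rewrite su.
  have us0 : 0 < u - s by rewrite subr_gt0.
  have umax' y : s <= y <= t -> D y <= D u by move=> yst; apply: umax; rewrite in_itv.
  have := df_sub_max df df0 k0 ka cg fg sut umax'.
  rewrite -/(D s) -/(D u).
  have := balanced_ramp_le mle n0 fX fab u bs.
  have := empirical_df_bound (X := X) df0 (ltW su) bound.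
  rewrite ler_norml => /andP[_ ub] ge le.
  rewrite rhoE ler_pdivlMr// -(ler_pM2r us0).
  by have := ler_wpM2r (ltW us0) Ds1'; lra.
Qed.

Lemma df_below x : x < a -> distribution_function f x = 0.
Proof.
move=> xa; rewrite /distribution_function (eq_Rintegral _ (g := fun=> 0)).
  by rewrite Rintegral_cst ?mul0r//; exact: measurable_itv.
move=> y; rewrite inE /= in_itv/= => yx; apply/eqP; apply/negPn/negP => /fab.
by rewrite leNgt (le_lt_trans yx xa).
Qed.

Lemma df_above x : b < x -> distribution_function f x = 1.
Proof.
move=> bx; rewrite -(density_Rintegral df) /distribution_function Rintegral_mkcond.
apply: eq_Rintegral => y _; rewrite patchE mem_setE in_itv/=.
case: ifPn => //; rewrite -ltNge => xy; apply/esym/eqP; apply/negPn/negP => /fab.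
by move=> /andP[_]; rewrite leNgt (lt_trans bx xy).
Qed.

End UniformBound.

Section SupNorm.
Context {R : realType}.

Lemma sup_norm_le (h : R -> R) (r : R) :
  (forall x, `|h x| <= r) -> (sup_norm h <= r%:E)%E.
Proof. by move=> le; apply: ge_ereal_sup => _ [x _ <-]; rewrite lee_fin. Qed.

Lemma sup_norm_fin (h : R -> R) (r : R) : (forall x, `|h x| <= r) ->
  exists d : R, sup_norm h = d%:E /\ forall x, `|h x| <= d.
Proof.
move=> le; have ub x : (`|h x|%:E <= sup_norm h)%E by apply: ereal_sup_ubound; exists x.
have fin : sup_norm h \is a fin_num.
  rewrite fin_numElt (lt_le_trans _ (ub 0)) ?ltNyr//=.
  exact: le_lt_trans (sup_norm_le le) (ltry _).
exists (fine (sup_norm h)); rewrite fineK//; split=> // x.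
by rewrite -lee_fin fineK.
Qed.
End SupNorm.

Theorem lemma2 (R : realType) (n : nat) (X : 'I_n -> R)
    (fhat f0 h0 : R -> R) (alpha0 : R) :
  (2 <= n)%N ->
  (exists i j : 'I_n, X i <> X j) ->
  is_log_concave_mle X fhat ->
  is_density f0 ->
  concave_on `[sample_min X, sample_max X] h0 ->
  (forall x, sample_min X <= x <= sample_max X ->
     f0 x = expR (alpha0 * x) * h0 x) ->
  let kappa := alpha0 * (sample_max X - sample_min X) in
  let F0 := distribution_function f0 in
  let Fhat := distribution_function fhat in
  (sup_norm (fun x => Fhat x - F0 x)%R
     <= (rho `|kappa|)%:E * sup_norm (fun x => empirical_df X x - F0 x)%R)%E.
Proof.
move=> n2 [i [j Xij]] mle df0 ch0 f0E.
cbv zeta; set F0 := distribution_function f0.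
set Fhat := distribution_function fhat.
have n0 : (0 < n)%N by exact: leq_trans n2.
have Xa := sample_min_attained X n0; have Xb := sample_max_attained X n0.
have Xab := sample_range X.
set a := sample_min X in Xa Xab ch0 f0E *.
set b := sample_max X in Xb Xab ch0 f0E *.
have ab : a < b.
  rewrite ltNge; apply/negP => ba; apply: Xij.
  by have /andP[? ?] := Xab i; have /andP[? ?] := Xab j; lra.
pose f x := fhat x * (a <= x <= b)%R%:R.
have [mlef Ff] := mle_restrict mle ab Xab Xa Xb; rewrite -/f in mlef Ff.
have fX := mle_gt0 mlef ab Xab.
have fab x : f x != 0 -> a <= x <= b.
  by rewrite /f; case: (a <= x <= b) => //; rewrite mulr0 eqxx.
have [|d [-> bound]] := @sup_norm_fin _ (fun x => empirical_df X x - F0 x) 1.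
  move=> x; have /andP[? ?] := empirical_df_itv X x n0.
  have /andP[? ?] := df_itv x df0.
  by rewrite ler_norml; apply/andP; split; rewrite /F0; lra.
rewrite -EFinM; apply: sup_norm_le => x; rewrite /Fhat -Ff.
have [xa|ax] := ltP x a.
  rewrite (df_below fab xa) -(empirical_df_below xa).
  exact: le_trans (bound x) (le_rho_mul a b alpha0 bound).
have [bx|xb] := ltP b x.
  rewrite (df_above mlef fab bx) -(empirical_df_above n0 bx).
  exact: le_trans (bound x) (le_rho_mul a b alpha0 bound).
apply: (df_sub_bound_in mlef n0 fX fab ab Xa Xb df0 ch0 f0E bound).
by rewrite ax.
Qed.
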